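(* Let $Q=(q_0,\dots,q_n)$ be a tuple of positive integers with $\gcd(q_0,\dots,q_n)=1$, let $\mathbf{P}(Q)=\mathbf{P}^n_{q_0,\dots,q_n}$ be the weighted projective space of type $Q$, and let $\Xi$ be its fan, with ray generators $v_0,\dots,v_n$. Then for every rational number $p\in[0,2n]$ the orbifold (Chen–Ruan) cohomology group of $\mathbf{P}(Q)$ is $$H^p_{orb}(\mathbf{P}(Q);\mathbf{Q})\cong\bigoplus_{\sigma\in\Xi,\ l\in\mathbf{Q}}H^{p-2l}(\overline{O}_\sigma;\mathbf{Q})\otimes\bigoplus_{t\in\sigma_l}\mathbf{Q}\,t,$$ where $\sigma_l=\{\sum_{v_i\in\sigma}a_iv_i\in N:\ a_i\in(0,1),\ \sum_{v_i\in\sigma}a_i=l\}$ (for $\sigma=0$ one takes only $l=0$, with $\bigoplus_{t\in\sigma_0}\mathbf{Q}t=\mathbf{Q}$), $\overline{O}_\sigma$ is the closure of the torus orbit corresponding to $\sigma$, and $H^{p-2l}(\overline{O}_\sigma;\mathbf{Q})=0$ if $p-2l$ is not an integer.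
   Context: Fan. Let $N=\mathbf{Z}^n$ and $d_{0\cdots j}=\gcd(q_0,\dots,q_j)$. Let $(c_{ij})_{1\le i,j\le n}$ be the upper triangular integer matrix with $c_{jj}=d_{0\cdots (j-1)}/d_{0\cdots j}$ and, for fixed $j\geq 2$ and successively $i=j-1,\dots,1$, $c_{ij}$ the smallest non-negative integer with $c_{ij}q_i+\sum_{\nu=i+1}^{j}c_{\nu j}q_\nu\in d_{0\cdots(i-1)}\mathbf{Z}$. Let $v_1,\dots,v_n\in N$ be its rows and $v_0=-\sum_{i=1}^n\frac{q_i}{q_0}v_i\in N$, so $\sum_{i=0}^n q_iv_i=0$. The fan $\Xi$ is the complete fan in $N\otimes\mathbf{R}$ whose cones are generated by the proper subsets of $\{v_0,\dots,v_n\}$ (including the cone $0$); $\mathbf{P}(Q)$ is its toric variety $X_\Xi$. The notation $v_i\in\sigma$ means that $v_i$ is one of the vectors generating $\sigma$. $O_\sigma$ is the torus orbit corresponding to $\sigma$. Orbifold structure. For an $n$-dimensional cone $\sigma$ let $N_\sigma\subset N$ be the sublattice generated by the $v_j$ that generate $\sigma$, and $G_\sigma=N/N_\sigma$. Each element of $G_\sigma$ is uniquely represented by a vector $g_a=\sum_{v_j\in\sigma}a_jv_j\in N$ with $a_j\in[0,1)$; it acts on $U_{\sigma'}\cong\mathbf{C}^n$ by the diagonal matrix with entries $e^{2\pi i a_j}$, and $U_\sigma=U_{\sigma'}/G_\sigma$ is the affine open subset of $X_\Xi$ attached to $\sigma$. The local group at a point of $O_\tau$ is $G_\tau=\{\sum_{v_j\in\tau}a_jv_j\in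 N: a_j\in[0,1)\}$. Orbifold cohomology. For a closed complex orbifold $X$ of complex dimension $n$ with local groups $G_p$, let $\widetilde X_1=\{(p,(g)_{G_p}): p\in X,\ g\in G_p\}$, with $(g)_{G_p}$ the conjugacy class; it is an orbifold, with local charts $V_p^g/C(g)$, and decomposes into connected components $X_{(g)}$, indexed by a set $T_1$; the component of $g=1$ is $X$. If $g\in G_p$ has order $m_g$ and acts on the tangent space of the local chart at $p$ with eigenvalues $e^{2\pi i m_{j,g}/m_g}$, $0\le m_{j,g}<m_g$, $j=1,\dots,n$, the degree shifting number is $\iota_{(g)}=\sum_{j=1}^n m_{j,g}/m_g$, constant on $X_{(g)}$. Then $H^p_{orb}(X;\mathbf{Q})=\bigoplus_{(g)\in T_1}H^{p-2\iota_{(g)}}(X_{(g)};\mathbf{Q})$, where cohomology in a non-integral degree is zero. *)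

(* Defs.v *)
From HB Require Import structures.
From Stdlib Require Import Relation_Operators.
From mathcomp Require Import all_boot all_order all_algebra generic_quotient.
From mathcomp Require Import all_classical all_reals all_analysis.
From mathcomp Require Import complex.

Set Implicit Arguments.
Unset Strict Implicit.
Unset Printing Implicit Defensive.
Import Order.TTheory GRing.Theory Num.Theory.
Import numFieldNormedType.Exports.
Local Open Scope classical_set_scope.
Local Open Scope ring_scope.

Section KernelModule.
Variables (K : pzRingType) (V W : lmodType K) (f : {linear V -> W}).

Definition kernel_pred : {pred V} := fun v => f v == 0.

Fact kernel_submod_closed : submod_closed kernel_pred.
Proof.
split=> [|a u v]; rewrite !unfold_in ?linear0 // => /eqP fu /eqP fv.
by rewrite linearP fu fv scaler0 addr0.
Qed.
HB.instance Definition _ := GRing.isSubmodClosed.Build K V kernel_pred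
  kernel_submod_closed.

Definition kernel_module := {v : V | v \in kernel_pred}.
HB.instance Definition _ := SubType.on kernel_module.
HB.instance Definition _ := Choice.on kernel_module.
HB.instance Definition _ := [SubChoice_isSubLmodule of kernel_module by <:].
End KernelModule.

Section QuotientModule.
Variables (K : pzRingType) (V : lmodType K).

Definition is_submodule (W : set V) :=
  W 0 /\ forall a u v, W u -> W v -> W (a *: u + v).

Definition span_of (S : set V) : set V :=
  [set v | forall W, is_submodule W -> S `<=` W -> W v].

Variable S : set V.
Definition span_pred : {pred V} := fun v => `[< span_of S v >].

Fact span_submod_closed : submod_closed span_pred.
Proof.
split=> [|a u v]; rewrite !unfold_in; first by apply/asboolP => W [].
move=> /asboolP Su /asboolP Sv; apply/asboolP => W sW SW.
by apply: sW.2; [exact: Su|exact: Sv].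
Qed.
HB.instance Definition _ := GRing.isSubmodClosed.Build K V span_pred
  span_submod_closed.

Definition quot_module := Quotient.quot span_pred.
HB.instance Definition _ := GRing.Zmodule.on quot_module.
HB.instance Definition _ := EqQuotient.on quot_module.

Local Open Scope quotient_scope.
Definition quot_scale (a : K) (x : quot_module) : quot_module :=
  \pi_quot_module (a *: repr x).

Lemma quot_scale_pi a (v : V) :
  quot_scale a (\pi_quot_module v) = \pi_quot_module (a *: v).
Proof.
apply/eqP; rewrite -Quotient.idealrBE -scalerBr.
apply: rpredZ.
by rewrite Quotient.idealrBE; apply/eqP; exact: reprK.
Qed.

Lemma quot_pi_surj (x : quot_module) : exists v, x = \pi_quot_module v.
Proof. by exists (repr x); rewrite reprK. Qed.

Lemma quot_piD (u v : V) :
  \pi_quot_module u + \pi_quot_module v = \pi_quot_module (u + v).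
Proof. by symmetry; exact: (Quotient.pi_add span_pred). Qed.

Fact quot_scaleA a b x : quot_scale a (quot_scale b x) = quot_scale (a * b) x.
Proof. by have [v ->] := quot_pi_surj x; rewrite !quot_scale_pi scalerA. Qed.
Fact quot_scale1 : left_id 1 quot_scale.
Proof.
by move=> x; have [v ->] := quot_pi_surj x; rewrite quot_scale_pi scale1r.
Qed.
Fact quot_scaleDr : right_distributive quot_scale +%R.
Proof.
move=> a x y; have [u ->] := quot_pi_surj x; have [v ->] := quot_pi_surj y.
by rewrite quot_piD !quot_scale_pi quot_piD scalerDr.
Qed.
Fact quot_scaleDl x : {morph quot_scale^~ x : a b / a + b}.
Proof.
move=> a b; have [v ->] := quot_pi_surj x.
by rewrite !quot_scale_pi quot_piD scalerDl.
Qed.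
HB.instance Definition _ := GRing.Zmodule_isLmodule.Build K quot_module
  quot_scaleA quot_scale1 quot_scaleDr quot_scaleDl.
End QuotientModule.

Section DirectSum.
Variables (K : pzRingType) (I : Type) (V : I -> lmodType K).

Definition direct_sum :=
  {f : forall i, V i | finite_set [set i | f i != 0]}.

HB.instance Definition _ := gen_eqMixin direct_sum.
HB.instance Definition _ := gen_choiceMixin direct_sum.

Implicit Types f g h : direct_sum.

Lemma direct_sumP f g : (forall i, sval f i = sval g i) -> f = g.
Proof.
case: f g => [f fF] [g gF] /= fg.
by apply: eq_exist; exact: functional_extensionality_dep.
Qed.

Fact dsum0_fin : finite_set [set i | (0 : V i) != 0].
Proof.
by rewrite (_ : [set _ | _] = set0) // -subset0 => i /=; rewrite eqxx.
Qed.
Definition dsum0 : direct_sum := exist _ (fun i => 0 : V i) dsum0_fin.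

Fact dsumN_fin f : finite_set [set i | - sval f i != 0].
Proof.
by apply: (sub_finite_set _ (svalP f)) => i /=; rewrite oppr_eq0.
Qed.
Definition dsumN f : direct_sum := exist _ (fun i => - sval f i) (dsumN_fin f).

Fact dsumD_fin f g : finite_set [set i | sval f i + sval g i != 0].
Proof.
have : finite_set ([set i | sval f i != 0] `|` [set i | sval g i != 0]).
  by rewrite finite_setU; split; [exact: (svalP f)|exact: (svalP g)].
apply: sub_finite_set => i /=; have [->|] := eqVneq (sval f i) 0; last by left.
by rewrite add0r; right.
Qed.
Definition dsumD f g : direct_sum :=
  exist _ (fun i => sval f i + sval g i) (dsumD_fin f g).

Fact dsumZ_fin a f : finite_set [set i | a *: sval f i != 0].
Proof.
apply: (sub_finite_set _ (svalP f)) => i /=.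
by apply: contraNneq => ->; rewrite scaler0.
Qed.
Definition dsumZ a f : direct_sum :=
  exist _ (fun i => a *: sval f i) (dsumZ_fin a f).

Fact dsumDA : associative dsumD.
Proof. by move=> f g h; apply: direct_sumP => i; exact: addrA. Qed.
Fact dsumDC : commutative dsumD.
Proof. by move=> f g; apply: direct_sumP => i; exact: addrC. Qed.
Fact dsum0D : left_id dsum0 dsumD.
Proof. by move=> f; apply: direct_sumP => i; exact: add0r. Qed.
Fact dsumND : left_inverse dsum0 dsumN dsumD.
Proof. by move=> f; apply: direct_sumP => i; exact: addNr. Qed.
HB.instance Definition _ :=
  GRing.isZmodule.Build direct_sum dsumDA dsumDC dsum0D dsumND.

Fact dsumZA a b f : dsumZ a (dsumZ b f) = dsumZ (a * b) f.
Proof. by apply: direct_sumP => i; exact: scalerA. Qed.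
Fact dsum1Z : left_id 1 dsumZ.
Proof. by move=> f; apply: direct_sumP => i; exact: scale1r. Qed.
Fact dsumZDr : right_distributive dsumZ +%R.
Proof. by move=> a f g; apply: direct_sumP => i; exact: scalerDr. Qed.
Fact dsumZDl f : {morph dsumZ^~ f : a b / a + b}.
Proof. by move=> a b; apply: direct_sumP => i; exact: scalerDl. Qed.
HB.instance Definition _ := GRing.Zmodule_isLmodule.Build K direct_sum
  dsumZA dsum1Z dsumZDr dsumZDl.
End DirectSum.

Definition free_module (K : pzRingType) (S : Type) : lmodType K :=
  direct_sum (fun _ : S => K^o).

Fact free_gen_fin (K : pzRingType) (S : Type) (s : S) :
  finite_set [set i : S | (`[< i = s >]%:R : K^o) != 0].
Proof.
apply: (@sub_finite_set _ _ [set s]); last exact: finite_set1.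
by move=> i /=; case: asboolP => // _; rewrite eqxx.
Qed.
Definition free_gen (K : pzRingType) (S : Type) (s : S) : free_module K S :=
  exist _ (fun i => `[< i = s >]%:R : K^o) (free_gen_fin K s).

Section TensorProduct.
Variables (K : comPzRingType) (V W : lmodType K).

Local Notation gen v w := (free_gen K (v, w)).

Definition bilinear_relations : set (free_module K (V * W)) :=
  [set x | (exists a v v' w,
              x = gen (a *: v + v') w - (a *: gen v w + gen v' w))
        \/ (exists a v w w',
              x = gen v (a *: w + w') - (a *: gen v w + gen v w'))].

Definition tensor : lmodType K := quot_module bilinear_relations.
End TensorProduct.

Definition lmod_iso (K : pzRingType) (V W : lmodType K) :=
  exists f : {linear V -> W}, bijective f.

Section SingularCohomology.
Variable R : realType.

Definition simplex_set k : set 'rV[R]_k.+1 :=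
  [set x | (forall i, 0 <= x 0 i) /\ \sum_i x 0 i = 1].
Definition simplex k : topologicalType := set_type (@simplex_set k).

Definition face_row k (i : 'I_k.+2) (x : 'rV[R]_k.+1) : 'rV[R]_k.+2 :=
  \row_j if unlift i j is Some j' then x 0 j' else 0.

Lemma face_row_simplex k (i : 'I_k.+2) (x : simplex k) :
  face_row i (val x) \in @simplex_set k.+1.
Proof.
have [x_ge0 x1] : @simplex_set k (val x) by exact: set_valP.
rewrite inE; split=> [j|]; first by rewrite mxE; case: unliftP.
rewrite (bigD1 i) //= mxE unlift_none add0r -x1.
rewrite (reindex_omap (lift i) (unlift i)) /=.
  apply: eq_big => [j|j _]; last by rewrite mxE liftK.
  by rewrite liftK eqxx andbT eq_sym neq_lift.
by move=> j ji; case: unliftP => [j' -> //|/eqP]; rewrite (negbTE ji).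
Qed.

Definition face k (i : 'I_k.+2) (x : simplex k) : simplex k.+1 :=
  exist (fun y => y \in @simplex_set k.+1) _ (face_row_simplex i x).

Lemma face_row_continuous k (i : 'I_k.+2) : continuous (@face_row k i).
Proof.
move=> x B [P xP PB].
exists (fun a j => P a (lift i j)) => [a j|y yP].
  by have := xP a (lift i j); rewrite mxE liftK ord1.
apply: PB => a j; have := nbhs_singleton (xP a j).
by rewrite !mxE; case: unliftP => // j' -> _; rewrite -(ord1 a).
Qed.

Lemma face_continuous k (i : 'I_k.+2) : continuous (face i).
Proof.
apply/continuousP => _ [B oB <-]; exists (@face_row k i @^-1` B) => //.
by move/continuousP: (@face_row_continuous k i); apply.
Qed.

Variables (X : topologicalType) (A : set X).

(* A is given the subspace topology: a continuous map to A is a continuous map to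
   X with values in A. *)
Record sing k := Sing {
  sing_fun :> simplex k -> X;
  sing_cont : continuous sing_fun;
  sing_in : forall x, A (sing_fun x) }.

Definition sing_face k (s : sing k.+1) (i : 'I_k.+2) : sing k.
Proof.
refine (@Sing k (s \o face i) _ _).
- by move=> x; apply: continuous_comp; [exact: face_continuous|exact: sing_cont].
- by move=> x; exact: sing_in.
Defined.

Definition cochain k : lmodType rat := sing k -> rat^o.

Definition coboundary k (c : cochain k) : cochain k.+1 :=
  fun s => \sum_(i < k.+2) (-1) ^+ i * c (sing_face s i).

Fact coboundary_linear k : linear (@coboundary k).
Proof.
move=> a c c'; apply/funext => s; rewrite /coboundary.
rewrite [RHS]/GRing.add /= [in RHS]/GRing.scale /= scaler_sumr -big_split /=.
apply: eq_bigr => i _.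
rewrite [X in _ * X]/GRing.add /= [in X in _ * X]/GRing.scale /=.
by rewrite mulrDr -!scalerAr.
Qed.
HB.instance Definition _ k := GRing.isLinear.Build rat (cochain k)
  (cochain k.+1) *:%R (@coboundary k) (@coboundary_linear k).

Definition cocycle k : lmodType rat := kernel_module (@coboundary k).

Definition coboundaries k : set (cocycle k) :=
  match k with
  | 0 => set0
  | k'.+1 => [set z | exists c, val z = @coboundary k' c]
  end.

Definition cohomology k : lmodType rat := quot_module (@coboundaries k).

(* Cohomology in a rational degree; it vanishes unless the degree is a natural
   number. *)
Definition rat_cohomology (p : rat) : lmodType rat :=
  if p \is a Num.nat then cohomology (Num.truncn p) else 'rV[rat]_0.
End SingularCohomology.

(* R[i] itself carries no topology; declared as a numClosedFieldType, it gets the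
   one of the norm. *)
Definition Cplx (R : realType) : numClosedFieldType := R[i].

Definition expi (R : realType) (t : rat) : Cplx R :=
  (cos (2 * pi * ratr t) +i* sin (2 * pi * ratr t))%C.

(* The cone generated by {v_i, i in s} is represented by the proper subset s of
   {0, ..., n}, so "v_i \in sigma" reads "i \in val sigma". *)
Definition fan n := {s : {set 'I_n.+1} | s \proper [set: 'I_n.+1]%SET}.

Fact max_cone_proper n (k : 'I_n.+1) : (~: [set k])%SET \proper [set: 'I_n.+1]%SET.
Proof. by rewrite finset.properT; apply/eqP => /setP/(_ k); rewrite !inE eqxx. Qed.

(* The n-dimensional cones; n of the n + 1 rays generate such a cone, and they
   are numbered by 'I_n through lift k. *)
Definition max_cone n (k : 'I_n.+1) : fan n :=
  exist (fun s : {set 'I_n.+1} => s \proper [set: 'I_n.+1]%SET) _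
    (max_cone_proper k).

Definition pairing n (m w : 'rV[int]_n) : int := \sum_i m 0 i * w 0 i.

Section ToricVariety.
Variables (R : realType) (n : nat) (v : 'I_n.+1 -> 'rV[int]_n).
Local Notation C := (Cplx R).

Definition pairingR (m : 'rV[int]_n) (x : 'rV[R]_n) : R :=
  \sum_i (m 0 i)%:~R * x 0 i.

Definition cone (s : fan n) : set 'rV[R]_n :=
  [set x | exists2 a : 'I_n.+1 -> R, forall i, 0 <= a i &
     x = \sum_(i in val s) a i *: map_mx intr (v i)].

Definition dual_cone (s : fan n) : set 'rV[int]_n :=
  [set m | forall x, cone s x -> 0 <= pairingR m x].

Definition orthogonal_cone (s : fan n) : set 'rV[int]_n :=
  [set m | forall x, cone s x -> pairingR m x = 0].

(* The affine toric variety: semigroup homomorphisms from the dual semigroup to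
   the multiplicative semigroup C, with the topology of pointwise convergence. *)
Definition semigroup_hom (s : fan n) : set {ptws set_type (dual_cone s) -> C} :=
  [set f | (forall m, val m = 0 -> f m = 1) /\
     (forall m m' m'', val m'' = val m + val m' -> f m'' = f m * f m')].
Definition affine_toric (s : fan n) : topologicalType :=
  set_type (@semigroup_hom s).

(* For a face t of s, the point y of the chart of s is the image of the point x
   of the chart of t under the inclusion of charts, i.e. under restriction of
   semigroup homomorphisms. *)
Definition glue (x y : {s : fan n & affine_toric s}) : Prop :=
  val (tag x) \subset val (tag y) /\
  forall (m : set_type (dual_cone (tag x))) (m' : set_type (dual_cone (tag y))),
    val m = val m' -> val (tagged x) m = val (tagged y) m'.

Definition glued (x y : {s : fan n & affine_toric s}) : bool :=
  `[< clos_refl_sym_trans _ glue x y >].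

Fact glued_equiv : equiv_class_of glued.
Proof.
split=> [x|x y|y x z]; first by apply/asboolP; exact: rst_refl.
- by apply/asboolP/asboolP; exact: rst_sym.
- by move=> /asboolP xy /asboolP yz; apply/asboolP; exact: rst_trans xy yz.
Qed.
Canonical glued_equiv_rel := EquivRelPack glued_equiv.

Definition toric_variety : topologicalType :=
  quotient_topology {eq_quot glued}%qT.

Definition toric_pi (x : {s : fan n & affine_toric s}) : toric_variety :=
  (\pi_({eq_quot glued}) x)%qT.

(* The orbit of the distinguished point of the chart of s, which is 1 on the
   orthogonal of s and 0 elsewhere, under the torus Hom(M, C^* ); a multiplicative
   t with t 0 = 1 has no zeros. *)
Definition torus_orbit (s : fan n) : set toric_variety :=
  [set p | exists t : 'rV[int]_n -> C, exists f : affine_toric s,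
    [/\ t 0 = 1 /\ (forall m m', t (m + m') = t m * t m'),
        (forall m : set_type (dual_cone s), val f m =
           if `[< orthogonal_cone s (val m) >] then t (val m) else 0)
      & p = toric_pi (existT _ s f)]].

(* Coordinates outside of s are irrelevant; those in s are necessarily rational
   since the v_i, i in s, are linearly independent vectors of N. *)
Definition coordinates (s : fan n) (a : 'I_n.+1 -> rat) (g : 'rV[int]_n) :=
  map_mx intr g = \sum_(i in val s) a i *: map_mx intr (v i) :> 'rV[rat]_n.

Definition in_box (s : fan n) (a : 'I_n.+1 -> rat) :=
  forall i, i \in val s -> 0 <= a i < 1.

(* The local group at the points of the orbit of s, each class of N / N_s being
   represented by its unique element in the half-open box. *)
Definition local_group (s : fan n) : set 'rV[int]_n :=
  [set g | exists2 a, in_box s a & coordinates s a g].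

Definition sublattice (s : fan n) : set 'rV[int]_n :=
  [set w | exists b : 'I_n.+1 -> int, w = \sum_(i in val s) b i *: v i].

Definition has_order (s : fan n) (g : 'rV[int]_n) (m : nat) :=
  [/\ (0 < m)%N, sublattice s (g *+ m)
    & forall m', (0 < m')%N -> sublattice s (g *+ m') -> (m <= m')%N].

Lemma dual_cone_pairing (s : fan n) (m : 'rV[int]_n) i :
  dual_cone s m -> i \in val s -> 0 <= pairing m (v i).
Proof.
move=> sm si; have -> : (0 <= pairing m (v i)) =
    (0 <= pairingR m (map_mx intr (v i))).
  rewrite -(ler0z R) /pairing /pairingR rmorph_sum /=; congr (_ <= _).
  by apply: eq_bigr => j _; rewrite mxE rmorphM.
apply: sm; exists (fun j => (j == i)%:R) => [j|]; first by rewrite ler0n.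
rewrite (bigD1 i) //= eqxx scale1r big1 ?addr0 // => j /andP[_ /negPf ->].
by rewrite scale0r.
Qed.

(* The quotient map from C^n, the j-th coordinate being attached to the ray
   v_(lift k j), to the affine chart of max_cone k: the point x is sent to the
   homomorphism m |-> \prod_j x_j ^ <m, v_(lift k j)>. *)
Definition chart_hom (k : 'I_n.+1) (x : 'rV[C]_n) :
    {ptws set_type (dual_cone (max_cone k)) -> C} :=
  fun m => \prod_j x 0 j ^+ `|pairing (val m) (v (lift k j))|%N.

Lemma chart_hom_subproof k x : @chart_hom k x \in @semigroup_hom (max_cone k).
Proof.
have ge0 (m : set_type (dual_cone (max_cone k))) j :
    0 <= pairing (val m) (v (lift k j)).
  apply: (@dual_cone_pairing (max_cone k)); first exact: set_valP.
  by rewrite !inE eq_sym neq_lift.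
rewrite inE; split=> [m m0|m m' m'' mE]; rewrite /chart_hom.
  rewrite big1 // => j _; rewrite m0 /pairing big1 ?expr0 // => i _.
  by rewrite mxE mul0r.
rewrite -big_split /=; apply: eq_bigr => j _; rewrite -exprD; congr (_ ^+ _).
have -> : pairing (val m'') (v (lift k j)) =
    pairing (val m) (v (lift k j)) + pairing (val m') (v (lift k j)).
  rewrite mE /pairing -big_split; apply: eq_bigr => i _.
  by rewrite mxE mulrDl.
apply/eqP; rewrite -eqz_nat PoszD.
by rewrite !gez0_abs ?addr_ge0 //; exact: ge0.
Qed.

Definition chart (k : 'I_n.+1) (x : 'rV[C]_n) : toric_variety :=
  toric_pi (existT affine_toric (max_cone k)
    (exist (fun f => f \in @semigroup_hom (max_cone k)) _
       (chart_hom_subproof k x))).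

(* The action on the chart C^n of max_cone k of the element of its group with
   coordinates a. *)
Definition action_mx (k : 'I_n.+1) (a : 'I_n.+1 -> rat) : 'M[C]_n :=
  diag_mx (\row_j expi R (a (lift k j))).

Definition fixed_set (k : 'I_n.+1) (a : 'I_n.+1 -> rat) : set 'rV[C]_n :=
  [set x | x *m action_mx k a = x].

(* Pairs (p, g) of a point and a vector of N; the inertia orbifold, made of the
   pairs such that g lies in the local group at p, is the subset "inertia" below
   (local groups are abelian, so their conjugacy classes are their elements).
   The topology is the finest one such that all charts V^g -> (V, g) of the
   inertia orbifold are continuous. *)
Definition point_vector : Type := (toric_variety * 'rV[int]_n)%type.
HB.instance Definition _ := Choice.on point_vector.

Definition inertia_chart k (a : 'I_n.+1 -> rat) (g : 'rV[int]_n)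
    (x : set_type (fixed_set k a)) : point_vector := (chart k (val x), g).

Definition point_vector_open (W : set point_vector) :=
  forall k a g, in_box (max_cone k) a -> coordinates (max_cone k) a g ->
    open (@inertia_chart k a g @^-1` W).

Fact point_vector_openT : point_vector_open setT.
Proof. by move=> k a g _ _; rewrite preimage_setT; exact: openT. Qed.
Fact point_vector_openI W W' :
  point_vector_open W -> point_vector_open W' -> point_vector_open (W `&` W').
Proof. by move=> oW oW' k a g ka ag; apply: openI; [exact: oW|exact: oW']. Qed.
Fact point_vector_open_bigU (I : Type) (W : I -> set point_vector) :
  (forall i, point_vector_open (W i)) -> point_vector_open (\bigcup_i W i).
Proof.
move=> oW k a g ka ag; rewrite preimage_bigcup.
by apply: bigcup_open => i _; exact: oW.
Qed.
HB.instance Definition _ := isOpenTopological.Build point_vector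
  point_vector_openT point_vector_openI point_vector_open_bigU.

Definition inertia : set point_vector :=
  [set y | exists2 s, torus_orbit s y.1 & local_group s y.2].

Definition sectors : set (set point_vector) :=
  [set S | exists2 y, inertia y & S = connected_component inertia y].

(* l is the degree shifting number at y = (p, g), computed in a chart at p *)
Definition degree_shift_at (y : point_vector) (l : rat) :=
  exists s k a m (e : 'I_n -> nat),
    [/\ torus_orbit s y.1 /\ val s \subset val (max_cone k),
        in_box (max_cone k) a /\ coordinates (max_cone k) a y.2,
        has_order s y.2 m /\ (forall j, e j < m)%N,
        char_poly (action_mx k a) =
          \prod_j ('X - (expi R ((e j)%:R / m%:R))%:P)
      & l = \sum_j (e j)%:R / m%:R].

(* The degree shifting number is constant on S. *)
Definition degree_shift (S : set point_vector) : rat :=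
  xget 0 [set l | exists2 y, S y & degree_shift_at y l].

Definition orbifold_cohomology (p : rat) : lmodType rat :=
  direct_sum (fun S : set_type sectors =>
    rat_cohomology R (val S) (p - 2 * degree_shift (val S))).

(* The set sigma_l; for s = 0 it is {0} if l = 0 and empty otherwise. *)
Definition open_box_vectors (s : fan n) (l : rat) : set 'rV[int]_n :=
  [set t | exists a, [/\ forall i, i \in val s -> 0 < a i < 1,
                         coordinates s a t & \sum_(i in val s) a i = l]].
End ToricVariety.

Section WeightedProjectiveSpace.
Variables (n : nat) (q : n.+1.-tuple nat).
Local Open Scope nat_scope.

Definition dgcd (j : nat) : nat := \big[gcdn/0]_(0 <= i < j.+1) nth 0 q i.

Definition smallest (P : pred nat) : nat :=
  if pselect (exists c, P c) is left exP then ex_minn exP else 0.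

(* The sequence of the entries c_(i,j) with i = j - k, ..., j of the j-th column (j >= 1). *)
Fixpoint fan_column (j k : nat) : seq nat :=
  if k is k'.+1 then
    let s := fan_column j k' in
    let i := j - k in
    smallest (fun c => dgcd i.-1 %|
      c * nth 0 q i + \sum_(i.+1 <= r < j.+1) nth 0 s (r - i.+1) * nth 0 q r)
    :: s
  else [:: dgcd j.-1 %/ dgcd j].

(* The matrix (c_ij), with indices starting at 1. *)
Definition fan_matrix (i j : nat) : nat :=
  if i <= j then nth 0 (fan_column j (j - i)) 0 else 0.

Local Open Scope ring_scope.

(* v_i is the i-th row of the matrix for i >= 1; the divisions by q_0 defining
   v_0 are exact. *)
Definition wps_ray (i : 'I_n.+1) : 'rV[int]_n :=
  \row_(j < n) if i == 0 :> nat then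
      - ((\sum_(1 <= r < n.+1) nth 0 q r * fan_matrix r j.+1) %/ nth 0 q 0)%N%:Z
    else (fan_matrix i j.+1)%:Z.
End WeightedProjectiveSpace.

(* Main.v *)
Require Import Defs.
From Stdlib Require Import Relation_Operators.
From HB Require Import structures.
From mathcomp Require Import all_boot all_order all_algebra generic_quotient finmap.
From mathcomp Require Import all_classical all_reals all_analysis.
From mathcomp Require Import complex.
From mathcomp Require Import lra zify.

Set Implicit Arguments.
Unset Strict Implicit.
Unset Printing Implicit Defensive.
Import Order.TTheory GRing.Theory Num.Theory.
Import numFieldNormedType.Exports.
Local Open Scope classical_set_scope.
Local Open Scope ring_scope.

(** The inertia orbifold of P(Q) splits according to the lattice vector g that
    labels a twisted sector, and each piece is a copy of an orbit closure.

    A vector g lying in some local group has a unique smallest cone containing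
    it; g is in the relative interior of the box of that cone sigma, and it
    belongs to the local group along an orbit O_tau exactly when sigma is a face
    of tau (local_group_sub, open_box_unique). Hence the points carrying g are
    the union of the O_tau with tau containing sigma, which is the closure of
    O_sigma (closure_torus_orbit, inertia_fiber). The part of the inertia
    orbifold over g is open and closed in it, and it is connected because every
    chart of it is a linear subspace through which any point can be joined by a
    segment to one fixed point. So the sectors are the sets
    (closure of O_sigma) x {g}, with sigma ranging over the fan and g over the
    vectors interior to the box of sigma (sector_component, sectors_sector).
    The eigenvalues of g are the exponentials of its box coordinates, so the
    degree shift of this sector is the sum l of these coordinates
    (degree_shift_sector). Summing over the vectors t in sigma_l amounts to
    tensoring with the free module on sigma_l (tensor_free_iso), and the theorem
    follows by reindexing.

    The inertia orbifold has the finest topology making its charts continuous,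
    whereas an orbit closure has the topology of a subspace of the toric variety,
    so the two cohomologies agree only because the charts C^n -> U_sigma
    identify U_sigma with a topological quotient. This holds because they are
    proper: for the dual basis vector m_j of a maximal cone, scaled by a positive
    integer D to be integral, the function m_j on U_sigma pulls back to x_j^D, so
    that bounded sets have bounded preimages (chart_elt_closed,
    sector_trace_closed).

    Points of the glued variety are handled through homogeneous coordinates z in
    C^(n+1), which represent the homomorphism m |-> prod_i z_i^<m,v_i>. Having
    coordinates z is invariant under the gluing of charts (glue_homogeneous), so
    the zero set of z, and with it the orbit, is well defined. The only facts on
    the rays that enter are that sum_i q_i v_i = 0 with positive q_i and that
    every rational linear relation is a multiple of this one (wps_ray_relation,
    wps_ray_relations). *)

(** * Linear algebra of direct sums, quotients and tensor products *)

Section LinearAlgebra.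
Variable K : comPzRingType.

Definition mk_linear (V W : lmodType K) (f : V -> W) (fL : linear f) :
  {linear V -> W} :=
  HB.pack f (GRing.isLinear.Build K V W *:%R f fL).

Section LinearFun.
Variables (V W : lmodType K) (f : V -> W).
Hypothesis fL : linear f.

Lemma linear_fun0 : f 0 = 0.
Proof. exact: (linear0 (mk_linear fL)). Qed.

Lemma linear_funZ a v : f (a *: v) = a *: f v.
Proof. by rewrite -[_ *: v]addr0 fL linear_fun0 addr0. Qed.

Lemma linear_funB u v : f (u - v) = f u - f v.
Proof. exact: (linearB (mk_linear fL)). Qed.

Lemma linear_fun_sum (I : Type) (r : seq I) (F : I -> V) :
  f (\sum_(i <- r) F i) = \sum_(i <- r) f (F i).
Proof. exact: (linear_sum (mk_linear fL)). Qed.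
End LinearFun.

Lemma lmod_isoI (V W : lmodType K) (f : V -> W) :
  linear f -> injective f -> (forall w, exists v, f v = w) -> lmod_iso V W.
Proof.
move=> fL fI fS; exists (mk_linear fL); have [g fg] := choice fS.
by exists g => [v|w] /=; [apply: fI; rewrite fg|rewrite fg].
Qed.

Lemma lmod_iso_refl (V : lmodType K) : lmod_iso V V.
Proof. by apply: (@lmod_isoI V V id) => // v; exists v. Qed.

Lemma lmod_iso_trans (V W U : lmodType K) :
  lmod_iso V W -> lmod_iso W U -> lmod_iso V U.
Proof.
move=> [f [f' fK f'K]] [g [g' gK g'K]]; apply: (@lmod_isoI V U (g \o f)).
- by move=> a u v /=; rewrite !linearP.
- by move=> u v /= /(can_inj gK) /(can_inj fK).
- by move=> w; exists (f' (g' w)); rewrite /= f'K g'K.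
Qed.

Lemma lmod_iso_sym (V W : lmodType K) : lmod_iso V W -> lmod_iso W V.
Proof.
move=> [f [g fK gK]]; apply: (@lmod_isoI W V g).
- by move=> a u v; apply: (can_inj fK); rewrite linearP !gK.
- exact: can_inj gK.
- by move=> v; exists (f v).
Qed.

Lemma direct_sum_iso (I : Type) (V W : I -> lmodType K) :
  (forall i, lmod_iso (V i) (W i)) -> lmod_iso (direct_sum V) (direct_sum W).
Proof.
move=> VW.
pose f i := projT1 (cid (VW i)); have fP i : bijective (f i) := projT2 (cid (VW i)).
have fin (h : direct_sum V) : finite_set [set i | f i (sval h i) != 0].
  apply: (sub_finite_set _ (svalP h)) => i /=.
  by apply: contraNneq => ->; rewrite linear0.
pose F (h : direct_sum V) : direct_sum W := exist _ (fun i => f i (sval h i)) (fin h).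
apply: (lmod_isoI (f := F)).
- by move=> a u v; apply: direct_sumP => i /=; rewrite linearP.
- move=> u v uv; apply: direct_sumP => i; have [g fK _] := fP i.
  by apply: (can_inj fK); have /(congr1 (fun x => sval x i)) := uv.
move=> w; have fP' i : exists g, cancel (f i) g /\ cancel g (f i).
  by have [g ? ?] := fP i; exists g.
pose g i := projT1 (cid (fP' i)).
have fgK i : cancel (f i) (g i) /\ cancel (g i) (f i) := projT2 (cid (fP' i)).
have gfin : finite_set [set i | g i (sval w i) != 0].
  apply: (sub_finite_set _ (svalP w)) => i /=.
  by apply: contraNneq => ->; rewrite -(linear0 (f i)) (fgK i).1.
exists (exist _ (fun i => g i (sval w i)) gfin); apply: direct_sumP => i /=.
exact: (fgK i).2.
Qed.

Lemma direct_sum_reindex (I J : Type) (phi : I -> J) (V : J -> lmodType K) :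
  injective phi -> (forall j, exists i, phi i = j) ->
  lmod_iso (direct_sum V) (direct_sum (V \o phi)).
Proof.
move=> phiI phiS; have [psi psiK] := choice phiS.
have fin (h : direct_sum V) : finite_set [set i | sval h (phi i) != 0].
  apply: (@sub_finite_set _ _ (psi @` [set j | sval h j != 0])).
    by move=> i hi; exists (phi i) => //; apply: phiI.
  by apply: finite_image; exact: svalP h.
pose F (h : direct_sum V) : direct_sum (V \o phi) :=
  exist _ (fun i => sval h (phi i)) (fin h).
apply: (lmod_isoI (f := F)).
- by move=> a u v; apply: direct_sumP.
- move=> u v uv; apply: direct_sumP => j; rewrite -(psiK j).
  by have /(congr1 (fun x => sval x (psi j))) := uv.
(* the value at j is found at a preimage of j and transported back to V j *)
move=> w; pose f j : V j := eq_rect _ V (sval w (psi j)) j (psiK j).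
have fphi i : f (phi i) = sval w i.
  rewrite /f; move: (psiK (phi i)); move: (psi (phi i)) => i' e.
  have ei := phiI _ _ e; move: e; rewrite ei => e.
  by rewrite (Prop_irrelevance e erefl).
have ffin : finite_set [set j | f j != 0].
  apply: (@sub_finite_set _ _ (phi @` [set i | sval w i != 0])).
    by move=> j /= fj; exists (psi j) => //=; rewrite -fphi psiK.
  by apply: finite_image; exact: svalP w.
by exists (exist _ f ffin); apply: direct_sumP => i /=; rewrite fphi.
Qed.

Lemma direct_sum_sigma (I : Type) (J : I -> Type)
    (V : forall i, J i -> lmodType K) :
  lmod_iso (direct_sum (fun i => direct_sum (@V i)))
           (direct_sum (fun ij : {i : I & J i} => V (tag ij) (tagged ij))).
Proof.
pose uncur (h : direct_sum (fun i => direct_sum (@V i))) (ij : {i : I & J i}) :=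
  sval (sval h (tag ij)) (tagged ij).
have fin (h : direct_sum (fun i => direct_sum (@V i))) :
    finite_set [set ij | uncur h ij != 0].
  apply: (@sub_finite_set _ _ (\bigcup_(i in [set i | sval h i != 0])
     (existT J i @` [set j | sval (sval h i) j != 0]))).
    move=> [i j] /= hij; exists i => /=; last by exists j.
    by apply: contra_neq hij; rewrite /uncur /= => ->.
  apply: bigcup_finite; first exact: svalP h.
  by move=> i _; apply: finite_image; exact: svalP (sval h i).
pose F (h : direct_sum (fun i => direct_sum (@V i))) :
    direct_sum (fun ij : {i : I & J i} => V (tag ij) (tagged ij)) :=
  exist _ (uncur h) (fin h).
apply: (lmod_isoI (f := F)).
- by move=> a u v; apply: direct_sumP.
- move=> u v uv; apply: direct_sumP => i; apply: direct_sumP => j.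
  by have /(congr1 (fun x => sval x (existT J i j))) := uv.
move=> w.
have wfin i : finite_set [set j | sval w (existT J i j) != 0].
  apply: (@sub_finite_set _ _ (existT J i @^-1` [set ij | sval w ij != 0])) => //.
  apply: finite_preimage; last exact: svalP w.
  move=> j j' _ _ e; have := projT2_eq e.
  by rewrite (Prop_irrelevance (projT1_eq e) erefl).
pose f i : direct_sum (@V i) := exist _ (fun j => sval w (existT J i j)) (wfin i).
have ffin : finite_set [set i | f i != 0].
  apply: (@sub_finite_set _ _ (tag @` [set ij | sval w ij != 0])).
    move=> i /= fi; apply: contrapT => H; move/eqP: fi; apply.
    apply: direct_sumP => j /=; apply: contrapT => /eqP wij.
    by apply: H; exists (existT J i j).
  by apply: finite_image; exact: svalP w.
by exists (exist _ f ffin); apply: direct_sumP => -[i j].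
Qed.

Section Lift.
Variables (I : Type) (V : I -> lmodType K) (W : lmodType K).
Variable g : forall i, {linear V i -> W}.

(** The universal map out of the direct sum. The index type is given the
    classical choice structure that finitely supported sums require. *)
Definition sum_lift (h : direct_sum V) : W :=
  \sum_(i \in [set i : {classic I} | sval h i != 0]) g i (sval h i).

Lemma sum_liftE (h : direct_sum V) (A : set I) :
  finite_set A -> (forall i, sval h i != 0 -> A i) ->
  sum_lift h = \sum_(i \in (A : set {classic I})) g i (sval h i).
Proof.
move=> Afin hA; apply: fsbig_widen => // i /= [_ /negP].
by rewrite negbK => /eqP ->; rewrite linear0.
Qed.

Lemma sum_lift_linear : linear sum_lift.
Proof.
move=> a u v.
pose A := [set i | sval u i != 0] `|` [set i | sval v i != 0].
have Afin : finite_set A.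
  by rewrite finite_setU; split; [exact: svalP u|exact: svalP v].
have uA i : sval u i != 0 -> A i by left.
have vA i : sval v i != 0 -> A i by right.
have uvA i : sval (a *: u + v) i != 0 -> A i.
  move=> /= uv; have [u0|] := eqVneq (sval u i) 0; last by left.
  by right; apply: contra_neq uv => v0; rewrite u0 v0 scaler0 addr0.
rewrite (sum_liftE Afin uA) (sum_liftE Afin vA) (sum_liftE Afin uvA).
rewrite !fsbig_finite // scaler_sumr -big_split /=.
by apply: eq_bigr => i _; rewrite linearP.
Qed.
End Lift.

Section Incl.
Variables (I : Type) (V : I -> lmodType K).

Definition incl_fun i (v : V i) : forall j, V j := fun j =>
  if pselect (i = j) is left e then eq_rect i V v j e else 0.

Lemma incl_fun_id i (v : V i) : incl_fun v i = v.
Proof.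
by rewrite /incl_fun; case: pselect => // e; rewrite (Prop_irrelevance e erefl).
Qed.

Lemma incl_fun_neq i (v : V i) j : i <> j -> incl_fun v j = 0.
Proof. by rewrite /incl_fun; case: pselect. Qed.

Fact incl_fin i (v : V i) : finite_set [set j | incl_fun v j != 0].
Proof.
apply: (@sub_finite_set _ _ [set i]) => [j /=|]; last exact: finite_set1.
by move=> vj; apply: contrapT => ij; case/eqP: vj; apply: incl_fun_neq => /esym.
Qed.
Definition incl i (v : V i) : direct_sum V := exist _ (incl_fun v) (incl_fin v).

Lemma incl_linear i : linear (@incl i).
Proof.
move=> a u v; apply: direct_sumP => j /=; have [<-|ij] := pselect (i = j).
  by rewrite !incl_fun_id.
by rewrite !incl_fun_neq // scaler0 addr0.
Qed.

Lemma sum_lift_incl (W : lmodType K) (g : forall i, {linear V i -> W}) i v :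
  sum_lift g (@incl i v) = g i v.
Proof.
rewrite (@sum_liftE _ _ _ _ _ [set i]); first last.
- move=> j /= vj; apply: contrapT => ij; case/eqP: vj.
  by apply: incl_fun_neq => /esym.
- exact: finite_set1.
by rewrite fsbig_set1 /= incl_fun_id.
Qed.

Lemma sum_incl (h : direct_sum V) :
  h = sum_lift (fun i => mk_linear (@incl_linear i)) h.
Proof.
apply: direct_sumP => j; rewrite /sum_lift fsbig_finite; last exact: svalP h.
pose ev (x : direct_sum V) := sval x j.
have ev0 : ev 0 = 0 by [].
have evD x y : ev (x + y) = ev x + ev y by [].
rewrite -[RHS]/(ev _) (big_morph ev evD ev0) /ev /=.
have [hj|hj] := eqVneq (sval h j) 0.
  rewrite hj big1_seq // => i /andP[_].
  rewrite in_fset_set; last exact: svalP h.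
  move=> /set_mem /= hi; apply: incl_fun_neq => ij; move: hi.
  by rewrite ij hj eqxx.
rewrite (bigD1_seq (j : {classic I})) /=; last exact: fset_uniq.
  rewrite incl_fun_id big1 ?addr0 // => i /eqP ij.
  exact: incl_fun_neq.
by rewrite in_fset_set; [exact/mem_set|exact: svalP h].
Qed.

(** The summands generate the direct sum, so a linear map is determined by its
    restrictions to them. *)
Lemma direct_sum_eq_linear (W : lmodType K) (f g : direct_sum V -> W) :
  linear f -> linear g -> (forall i v, f (@incl i v) = g (@incl i v)) -> f =1 g.
Proof.
move=> fL gL fg h; rewrite (sum_incl h) /sum_lift.
rewrite fsbig_finite ?(svalP h) //; last exact: svalP h.
rewrite (linear_fun_sum fL) (linear_fun_sum gL).
by apply: eq_bigr => i _; exact: fg.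
Qed.
End Incl.

Lemma free_genE (S : Type) (s : S) : free_gen K s = @incl S (fun _ => K^o) s 1.
Proof.
apply: direct_sumP => i /=; case: asboolP => [->|/nesym si].
  by rewrite incl_fun_id.
by rewrite incl_fun_neq.
Qed.

Local Open Scope quotient_scope.

Lemma quot_pi_linear (V : lmodType K) (S : set V) :
  linear (\pi_(quot_module S) : V -> quot_module S).
Proof. by move=> a u v; rewrite -quot_piD -quot_scale_pi. Qed.

Lemma quot_pi_eq0 (V : lmodType K) (S : set V) v :
  (\pi_(quot_module S) v = 0) <-> span_of S v.
Proof.
have <- : \pi_(quot_module S) 0 = 0 by exact: linear_fun0 (quot_pi_linear S).
have := Quotient.idealrBE (span_pred S) v 0; rewrite subr0 unfold_in => E.
by split=> [/eqP|/asboolP Sv]; [rewrite -E => /asboolP|apply/eqP; rewrite -E].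
Qed.

Lemma span_linear (V W : lmodType K) (S : set V) (f : V -> W) v :
  linear f -> (forall s, S s -> f s = 0) -> span_of S v -> f v = 0.
Proof.
move=> fL fS Sv; apply: (Sv [set v | f v = 0]) => //; split; first exact: linear_fun0.
by move=> a u w /= fu fw; rewrite fL fu fw scaler0 addr0.
Qed.

Lemma span_in (V : lmodType K) (S : set V) v : S v -> span_of S v.
Proof. by move=> Sv W _; apply. Qed.

Section TensorFree.
Variables (V : lmodType K) (S : Type).
Local Notation F := (free_module K S).
Local Notation T := (tensor V F).
Local Notation D := (direct_sum (fun _ : S => V)).

Definition tens (v : V) (w : F) : T := \pi_(quot_module _) (free_gen K (v, w)).

Lemma tens_linear_l w : linear (tens^~ w).
Proof.
move=> a u v; apply/eqP; rewrite -subr_eq0; apply/eqP.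
rewrite /tens -(quot_pi_linear _ a).
rewrite -(linear_funB (quot_pi_linear (@bilinear_relations K V F))).
by apply: (quot_pi_eq0 _ _).2; apply: span_in; left; exists a, u, v, w.
Qed.

Lemma tens_linear_r v : linear (tens v).
Proof.
move=> a u w; apply/eqP; rewrite -subr_eq0; apply/eqP.
rewrite /tens -(quot_pi_linear _ a).
rewrite -(linear_funB (quot_pi_linear (@bilinear_relations K V F))).
by apply: (quot_pi_eq0 _ _).2; apply: span_in; right; exists a, v, u, w.
Qed.

Fact eval_fin (v : V) (w : F) : finite_set [set s | sval w s *: v != 0].
Proof.
apply: (sub_finite_set _ (svalP w)) => s /=.
by apply: contraNneq => ->; rewrite scale0r.
Qed.
Definition eval_tensor (v : V) (w : F) : D :=
  exist _ (fun s => sval w s *: v) (eval_fin v w).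

Fact eval_gen_linear (vw : V * F) :
  linear (fun c : K^o => c *: eval_tensor vw.1 vw.2).
Proof. by move=> a c c'; rewrite scalerDl scalerA. Qed.

(** The map out of the tensor product, before passing to the quotient by the
    bilinear relations: a pair (v, w) goes to the family of the w(s) v. *)
Definition eval_free : free_module K (V * F) -> D :=
  sum_lift (fun vw => mk_linear (eval_gen_linear vw)).

Lemma eval_free_linear : linear eval_free. Proof. exact: sum_lift_linear. Qed.

Lemma eval_free_gen v w : eval_free (free_gen K (v, w)) = eval_tensor v w.
Proof. by rewrite /eval_free free_genE sum_lift_incl /= scale1r. Qed.

Lemma eval_free_rel x : bilinear_relations x -> eval_free x = 0.
Proof.
have L := eval_free_linear; have B := linear_funB L.
case=> [[a [v [v' [w ->]]]]|[a [v [w [w' ->]]]]]; rewrite B L !eval_free_gen;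
  apply: direct_sumP => s /=; apply/eqP; rewrite subr_eq0; apply/eqP.
  by rewrite scalerDr !scalerA mulrC.
by rewrite scalerDl scalerA.
Qed.

Definition tensor_of : D -> T :=
  sum_lift (fun s => mk_linear (tens_linear_l (free_gen K s))).

(** Both sides are linear in w, so that it suffices to compare them on the
    generators of the free module. *)
Lemma tensor_of_eval v w : tensor_of (eval_tensor v w) = tens v w.
Proof.
have eL : linear (fun w => tensor_of (eval_tensor v w)).
  move=> a x y; rewrite -(sum_lift_linear _ a); congr (tensor_of _).
  by apply: direct_sumP => s /=; rewrite scalerDl scalerA.
apply: (direct_sum_eq_linear eL (tens_linear_r v)) => s c.
have -> : @incl S (fun _ => K^o) s c = c *: (free_gen K s : F).
  rewrite free_genE -(linear_funZ (@incl_linear S (fun _ => K^o) s)).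
  by rewrite [_ *: (1 : K^o)]mulr1.
transitivity (tensor_of (@incl S (fun _ => V) s (c *: v))).
  congr (tensor_of _); apply: direct_sumP => t /=.
  have [->|st] := pselect (t = s).
    rewrite (asbool_equiv_eq (Q := True)) // asboolT // incl_fun_id.
    by rewrite /GRing.scale /= mulr1.
  rewrite asboolF // incl_fun_neq; last exact/nesym.
  by rewrite [X in X *: v](_ : _ = 0) ?scale0r // /GRing.scale /= mulr0.
rewrite /tensor_of sum_lift_incl /=.
rewrite (linear_funZ (tens_linear_l _)).
by rewrite (linear_funZ (tens_linear_r _)).
Qed.

Lemma tensor_of_eval_free x : tensor_of (eval_free x) = \pi_(quot_module _) x.
Proof.
have eL : linear (fun x => tensor_of (eval_free x)).
  by move=> a y z; rewrite eval_free_linear; exact: sum_lift_linear.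
apply: (direct_sum_eq_linear eL (quot_pi_linear _)) => -[v w] c.
have -> : @incl _ (fun _ => K^o) (v, w) c = c *: (free_gen K (v, w)).
  rewrite free_genE -(linear_funZ (@incl_linear _ (fun _ => K^o) (v, w))).
  by rewrite [_ *: (1 : K^o)]mulr1.
rewrite (linear_funZ eL) (linear_funZ (quot_pi_linear _)).
by rewrite eval_free_gen tensor_of_eval.
Qed.

Lemma eval_free_lift (h : D) : exists2 x, eval_free x = h &
  tensor_of h = \pi_(quot_module _) x.
Proof.
suff [x xh] : exists x, eval_free x = h.
  by exists x => //; rewrite -tensor_of_eval_free xh.
pose incl_gen (s : S) (v : V) := free_gen K (v, free_gen K s : F).
exists (\sum_(s <- fset_set [set s : {classic S} | sval h s != 0]) incl_gen s (sval h s)).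
rewrite (linear_fun_sum eval_free_linear) [RHS]sum_incl /sum_lift.
rewrite fsbig_finite; last exact: svalP h.
apply: eq_bigr => s _ /=; rewrite eval_free_gen; apply: direct_sumP => t /=.
have [->|st] := pselect (t = s); first by rewrite asboolT // scale1r incl_fun_id.
by rewrite asboolF // scale0r incl_fun_neq //; exact/nesym.
Qed.

(** The two maps tensor_of and eval_free are mutually inverse modulo the relations;
    working with eval_free before the quotient avoids choosing representatives. *)
Lemma tensor_free_iso : lmod_iso T D.
Proof.
apply: lmod_iso_sym; apply: (lmod_isoI (f := tensor_of)).
- exact: sum_lift_linear.
- suff inj0 h : tensor_of h = 0 -> h = 0.
    move=> u v uv; apply/eqP; rewrite -subr_eq0; apply/eqP/inj0.
    by rewrite (linear_funB (f := tensor_of) (sum_lift_linear _)) uv subrr.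
  have [x <- ->] := eval_free_lift h => /quot_pi_eq0 Sx.
  exact: span_linear eval_free_linear eval_free_rel Sx.
- move=> t; have [x ->] := quot_pi_surj t.
  by exists (eval_free x); exact: tensor_of_eval_free.
Qed.
End TensorFree.
End LinearAlgebra.

Section QuotIso.
Variables (K : comPzRingType) (V W : lmodType K) (S : set V) (S' : set W).
Variables (f : V -> W) (g : W -> V).
Hypotheses (fL : linear f) (gL : linear g) (fK : cancel f g) (gK : cancel g f).
Hypotheses (fS : forall s, S s -> S' (f s)) (gS : forall s, S' s -> S (g s)).
Local Open Scope quotient_scope.

Lemma quot_iso : lmod_iso (quot_module S) (quot_module S').
Proof.
have piS := quot_pi_linear S; have piS' := quot_pi_linear S'.
pose F (x : quot_module S) := \pi_(quot_module S') (f (repr x)).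
have pif0 v : \pi_(quot_module S) v = 0 -> \pi_(quot_module S') (f v) = 0.
  move=> /quot_pi_eq0; apply: (span_linear (f := \pi_(quot_module S') \o f)).
    by move=> a u w /=; rewrite fL piS'.
  by move=> s /fS ?; apply: (quot_pi_eq0 _ _).2; exact: span_in.
have pig0 v : \pi_(quot_module S') v = 0 -> \pi_(quot_module S) (g v) = 0.
  move=> /quot_pi_eq0; apply: (span_linear (f := \pi_(quot_module S) \o g)).
    by move=> a u w /=; rewrite gL piS.
  by move=> s /gS ?; apply: (quot_pi_eq0 _ _).2; exact: span_in.
have FE v : F (\pi_(quot_module S) v) = \pi_(quot_module S') (f v).
  apply/eqP; rewrite -subr_eq0 /F -(linear_funB piS') -(linear_funB fL).
  by apply/eqP/pif0; rewrite (linear_funB piS) reprK subrr.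
apply: (lmod_isoI (f := F)).
- move=> a x y; have [u ->] := quot_pi_surj x; have [v ->] := quot_pi_surj y.
  by rewrite -piS !FE fL piS'.
- move=> x y; have [u ->] := quot_pi_surj x; have [v ->] := quot_pi_surj y.
  rewrite !FE => /eqP; rewrite -subr_eq0 -(linear_funB piS') -(linear_funB fL).
  move=> /eqP /pig0; rewrite fK (linear_funB piS) => /eqP.
  by rewrite subr_eq0 => /eqP.
- move=> y; have [w ->] := quot_pi_surj y.
  by exists (\pi_(quot_module S) (g w)); rewrite FE gK.
Qed.
End QuotIso.

(** * Singular cohomology under maps of subspaces *)

Lemma kernel_val_linear (K : pzRingType) (V W : lmodType K) (f : {linear V -> W}) :
  linear (fun z : kernel_module f => val z).
Proof. by move=> a u v; exact: linearP. Qed.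

Section Cohomology.
Variable R : realType.

(** Cohomology of a subspace depends only on the continuous maps from simplices
    into it, so functoriality is needed only for maps that are continuous along
    those simplices. This accommodates maps defined on the whole space but
    continuous only in restriction to the subspace. *)
Definition sing_map (X Y : topologicalType) (A : set X) (B : set Y) (f : X -> Y) :=
  forall k (s : simplex R k -> X), continuous s -> (forall x, A (s x)) ->
    continuous (f \o s) /\ forall x, B (f (s x)).

Lemma sing_eq (X : topologicalType) (A : set X) k (s t : sing R A k) :
  (forall x, s x = t x) -> s = t.
Proof.
case: s t => [s sc sA] [t tc tA] /= /funext st; subst t.
by rewrite (Prop_irrelevance sc tc) (Prop_irrelevance sA tA).
Qed.

Section Functoriality.
Variables (X Y : topologicalType) (A : set X) (B : set Y) (f : X -> Y).
Hypothesis fAB : sing_map A B f.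

Definition push k (s : sing R A k) : sing R B k :=
  let sP := fAB (@sing_cont _ _ _ _ s) (@sing_in _ _ _ _ s) in Sing sP.1 sP.2.

Definition pull k (c : cochain R B k) : cochain R A k := fun s => c (push s).

Lemma pull_linear k : linear (@pull k). Proof. by []. Qed.

Lemma pull_coboundary k (c : cochain R B k) :
  pull (coboundary c) = coboundary (pull c).
Proof.
apply/funext => s; rewrite /pull /coboundary; apply: eq_bigr => i _.
by congr (_ * c _); apply: sing_eq.
Qed.

Lemma pull_cocycle k (z : cocycle R B k) :
  pull (val z) \in kernel_pred (@coboundary R X A k).
Proof.
have /eqP z0 : coboundary (val z) == 0 := valP z.
apply/eqP; rewrite [LHS](esym (pull_coboundary (val z))) z0.
by apply/funext.
Qed.

Definition pull_cocycle_map k (z : cocycle R B k) : cocycle R A k :=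
  exist _ (pull (val z)) (pull_cocycle z).

Lemma pull_cocycle_map_linear k : linear (@pull_cocycle_map k).
Proof.
move=> a u v; apply: val_inj; rewrite [RHS]kernel_val_linear.
rewrite -[RHS](pull_linear a (val u) (val v)) -[RHS]/(pull (_ *: val u + val v)).
by rewrite /pull_cocycle_map SubK kernel_val_linear.
Qed.

Lemma pull_coboundaries k (z : cocycle R B k) :
  coboundaries z -> coboundaries (pull_cocycle_map z).
Proof.
case: k z => [//|k] z [c zc]; exists (pull c).
by rewrite -pull_coboundary -zc.
Qed.
End Functoriality.

Variables (X Y : topologicalType) (A : set X) (B : set Y).
Variables (f : X -> Y) (g : Y -> X).
Hypotheses (fAB : sing_map A B f) (gBA : sing_map B A g).
Hypotheses (fK : forall x, A x -> g (f x) = x).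
Hypotheses (gK : forall y, B y -> f (g y) = y).

Lemma cohomology_iso k : lmod_iso (cohomology R A k) (cohomology R B k).
Proof.
apply: (quot_iso (pull_cocycle_map_linear gBA (k := k))
  (pull_cocycle_map_linear fAB (k := k))).
- move=> z; apply: val_inj; apply/funext => s /=; congr (val z _).
  by apply: sing_eq => x /=; rewrite fK //; exact: sing_in.
- move=> z; apply: val_inj; apply/funext => s /=; congr (val z _).
  by apply: sing_eq => x /=; rewrite gK //; exact: sing_in.
- by move=> z; exact: pull_coboundaries.
- by move=> z; exact: pull_coboundaries.
Qed.

Lemma rat_cohomology_iso p : lmod_iso (rat_cohomology R A p) (rat_cohomology R B p).
Proof.
rewrite /rat_cohomology; case: ifP => _; last exact: lmod_iso_refl.
exact: cohomology_iso.
Qed.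
End Cohomology.

(** * Polynomials, characters and the topology of the complex numbers *)

Lemma prod_XsubC_perm_eq (F : fieldType) (s t : seq F) :
  \prod_(x <- s) ('X - x%:P) = \prod_(x <- t) ('X - x%:P) -> perm_eq s t.
Proof.
elim: s t => [|x s IH] t st.
  have := congr1 (fun p : {poly F} => size p) st.
  by rewrite big_nil size_poly1 size_prod_XsubC; case: t {st}.
have xt : x \in t.
  by rewrite -root_prod_XsubC -st big_cons rootM root_XsubC eqxx.
rewrite perm_sym (perm_trans (perm_to_rem xt)) // perm_cons perm_sym; apply: IH.
apply: (@mulfI _ ('X - x%:P)); first by rewrite polyXsubC_eq0.
by have := st; rewrite big_cons (perm_big _ (perm_to_rem xt)) big_cons.
Qed.

Lemma exprz_sum (F : fieldType) (x : F) (I : Type) (r : seq I)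
    (k : I -> int) :
  x != 0 -> \prod_(i <- r) x ^ k i = x ^ (\sum_(i <- r) k i).
Proof.
move=> x0; elim: r => [|i r IH]; first by rewrite !big_nil expr0z.
by rewrite !big_cons IH -expfzDr.
Qed.

Lemma character_prod (F : fieldType) n (t : 'rV[int]_n -> F) :
  t 0 = 1 -> (forall m m', t (m + m') = t m * t m') ->
  forall m, t m = \prod_l t (delta_mx 0 l) ^ m 0 l.
Proof.
move=> t0 tD m.
have tV u : t (- u) = (t u)^-1.
  have uE : t u * t (- u) = 1 by rewrite -tD subrr.
  have u0 : t u != 0.
    by apply: contra_eq_neq uE => ->; rewrite mul0r eq_sym oner_neq0.
  by apply: (mulfI u0); rewrite uE divff.
have tMn u k : t (u *+ k) = t u ^+ k.
  by elim: k => [|k IH]; rewrite ?mulr0n ?expr0 // mulrS tD IH exprS.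
have tZ u (a : int) : t (a *: u) = t u ^ a.
  case: a => k; first by rewrite -[Posz k]natz scaler_nat tMn natz.
  by rewrite NegzE -[Posz _]natz scaleNr tV scaler_nat tMn natz -exprnN.
rewrite {1}[m]row_sum_delta (big_morph t tD t0).
by apply: eq_bigr => l _; rewrite tZ.
Qed.

Section ComplexTopology.
Variable R : realType.
Local Notation C := (Cplx R).

Lemma real_complex_norm (x : R) : `|x%:C%C : C| = (`|x|)%:C%C.
Proof. by rewrite [LHS]normc_def /= expr0n /= addr0 sqrtr_sqr. Qed.

Lemma real_complex_lt (x y : R) : ((x%:C%C : C) < y%:C%C) = (x < y).
Proof. exact: ltcR. Qed.

Lemma real_complex_continuous : continuous (fun x : R => x%:C%C : C).
Proof.
move=> x; apply/cvgrPdist_lt => e e0.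
have [r eE] : exists r : R, e = r%:C%C.
  by have /complex_realP := gtr0_real e0.
have r0 : 0 < r by rewrite -ltcR -eE.
near=> y.
have -> : (x%:C%C : C) - y%:C%C = (x - y)%:C%C by rewrite rmorphB.
rewrite real_complex_norm eE real_complex_lt.
near: y; apply: (@cvgr_dist_lt _ R^o) => //.
Unshelve. all: by end_near.
Qed.

(** The square of side 2M is the continuous image of a product of two compact
    intervals. *)
Lemma disc_in_compact (M : C) : M \is Num.real ->
  exists2 A : set C, compact A & forall z, `|z| <= M -> A z.
Proof.
move=> /complex_realP[r ->].
pose f (ab : R * R) : C := ab.1%:C%C + 'i * ab.2%:C%C.
have fc : continuous f.
  move=> ab; apply: cvgD.
    by apply: continuous_comp; [exact: cvg_fst|exact: real_complex_continuous].
  apply: cvgMr; apply: continuous_comp; first exact: cvg_snd.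
  exact: real_complex_continuous.
exists (f @` (`[(- r), r]%classic `*` `[(- r), r]%classic)).
  apply: continuous_compact; first exact: continuous_subspaceT.
  by apply: compact_setX; exact: segment_compact.
case=> a b; rewrite normc_def /= lecR => abr.
have ar : `|a| <= r.
  rewrite -sqrtr_sqr; apply: le_trans abr; rewrite ler_wsqrtr // lerDl.
  exact: sqr_ge0.
have br : `|b| <= r.
  rewrite -sqrtr_sqr; apply: le_trans abr; rewrite ler_wsqrtr // lerDr.
  exact: sqr_ge0.
exists (a, b).
  by split; rewrite /= in_itv /= -ler_norml.
by rewrite /f /= [RHS]complexE.
Qed.

Lemma separated_hausdorff (T U : topologicalType) : hausdorff_space U ->
  (forall x y : T, x <> y -> exists2 f : T -> U, continuous f & f x <> f y) ->
  hausdorff_space T.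
Proof.
move=> hU sep p q pq; apply: contrapT => /sep[f fc]; apply; apply: hU => A B pA qB.
by have [x [Ax Bx]] := pq _ _ (fc _ _ pA) (fc _ _ qB); exists (f x).
Qed.

Lemma row_continuous (T U : topologicalType) n (g : T -> 'rV[U]_n) :
  (forall j, continuous (fun t => g t 0 j)) -> continuous g.
Proof.
move=> gc t B [P xP PB].
apply: (@filterS _ _ _ [set y | forall j, P 0 j (g y 0 j)]).
  by move=> y yP; apply: PB => i j; rewrite ord1; exact: yP.
by apply: filter_forall => j; apply: gc; exact: xP.
Qed.

Lemma prod_continuous (T : topologicalType) (I : Type) (r : seq I)
    (F : I -> T -> C) :
  (forall i, continuous (F i)) -> continuous (fun t => \prod_(i <- r) F i t).
Proof.
move=> Fc; elim: r => [|i r IH].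
  under [X in continuous X]eq_fun do rewrite big_nil.
  exact: cst_continuous.
under [X in continuous X]eq_fun do rewrite big_cons.
by move=> t; apply: cvgM; [exact: Fc|exact: IH].
Qed.

Lemma expr_continuous (T : topologicalType) (F : T -> C) N :
  continuous F -> continuous (fun t => F t ^+ N).
Proof.
move=> Fc; elim: N => [|N IH].
  under [X in continuous X]eq_fun do rewrite expr0.
  exact: cst_continuous.
under [X in continuous X]eq_fun do rewrite exprS.
by move=> t; apply: cvgM; [exact: Fc|exact: IH].
Qed.

Lemma norm_exp_le (x M : C) D : (0 < D)%N -> `|x| ^+ D <= M -> `|x| <= 1 + M.
Proof.
move=> D0 xM; have xr : `|x| \is Num.real by exact: normr_real.
have M0 : 0 <= M by apply: le_trans xM; exact: exprn_ge0.
have [x1|x1] := real_leP xr (@real1 C).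
  by apply: le_trans x1 _; rewrite lerDl.
apply: le_trans (_ : M <= _); last by rewrite lerDr.
apply: le_trans xM; apply: ler_eXnr => //.
exact: ltW.
Qed.
End ComplexTopology.

Section Expi.
Variable R : realType.
Local Notation C := (Cplx R).

Lemma cos_2pi_eq1 (t : rat) : 0 <= t < 1 -> cos (2 * pi * ratr t : R) = 1 -> t = 0.
Proof.
move=> /andP[t0 t1] ct; pose th : R := 2 * pi * ratr t.
have pi0 : 0 < pi :> R := pi_gt0 R.
have rt0 : 0 <= ratr t :> R by rewrite ler0q.
have rt1 : ratr t < 1 :> R.
  by rewrite -(rmorph1 (ratr : {rmorphism rat -> R})) ltr_rat.
have th0 : 0 <= th.
  by apply: mulr_ge0 => //; apply: mulr_ge0; [exact: ler0n|exact: ltW].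
have th2 : th < 2 * pi by rewrite /th gtr_pMr // mulr_gt0.
have [thpi|thpi] := lerP th pi.
  have : th = 0.
    by apply: cos_inj; rewrite ?in_itv /= ?th0 ?thpi ?lexx ?cos0 // ltW.
  move=> th_eq0; apply/eqP; rewrite eq_le t0 andbT leNgt -(ltr0q R); apply/negP => rt.
  have : 0 < th by apply: mulr_gt0 => //; apply: mulr_gt0.
  by rewrite th_eq0 ltxx.
(* the cosine is injective on [0, pi] only; reflect the angle there *)
have cth : cos th = 1 := ct; clearbody th.
have : 2 * pi - th = 0.
  apply: cos_inj.
  - by rewrite in_itv /= subr_ge0 ltW //= lerBlDr mulrDl mul1r lerD2l ltW.
  - by rewrite in_itv /= lexx ltW.
  by rewrite cos0 addrC mulr_natl cosD2pi cosN.
by move/eqP; rewrite subr_eq0 (gt_eqF th2).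
Qed.

Lemma expi0 : expi R 0 = 1.
Proof. by rewrite /expi rmorph0 mulr0 cos0 sin0. Qed.

Lemma expi_eq (a b : rat) : expi R a = expi R b ->
  cos (2 * pi * ratr (a - b) : R) = 1.
Proof.
rewrite /expi => -[ca sa]; rewrite rmorphB mulrBr cosB ca sa -!expr2.
exact: cos2Dsin2.
Qed.

Lemma expi_inj (a b : rat) :
  0 <= a < 1 -> 0 <= b < 1 -> expi R a = expi R b -> a = b.
Proof.
move=> /andP[a0 a1] /andP[b0 b1] ab; have [ba|ba] := lerP b a.
  have /cos_2pi_eq1 H := expi_eq ab.
  by apply/eqP; rewrite -subr_eq0; apply/eqP/H; lra.
have /cos_2pi_eq1 H := expi_eq (esym ab).
by apply/esym/eqP; rewrite -subr_eq0; apply/eqP/H; lra.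
Qed.

(** The polynomial determines the multiset of its roots, and on [0, 1) the
    argument is a function of the root. *)
Lemma sum_expi (m : nat) (a b : 'I_m -> rat) :
  (forall j, 0 <= a j < 1) -> (forall j, 0 <= b j < 1) ->
  \prod_j ('X - (expi R (a j))%:P) = \prod_j ('X - (expi R (b j))%:P) ->
  \sum_j a j = \sum_j b j.
Proof.
move=> a01 b01 ab.
pose arg (z : C) : rat := xget 0 [set t | 0 <= t < 1 /\ expi R t = z].
have argK t : 0 <= t < 1 -> arg (expi R t) = t.
  move=> t01; have := @xgetPex _ 0 [set u | 0 <= u < 1 /\ expi R u = expi R t].
  by move=> /(_ (ex_intro _ t (conj t01 erefl)))[u01]; exact: expi_inj.
have sumE (c : 'I_m -> rat) : (forall j, 0 <= c j < 1) ->
    \sum_j c j = \sum_(z <- [seq expi R (c j) | j <- index_enum 'I_m]) arg z.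
  move=> c01; rewrite big_map; apply: eq_bigr => j _.
  by rewrite argK.
rewrite !sumE //; apply: perm_big; apply: prod_XsubC_perm_eq.
by rewrite !big_map.
Qed.
End Expi.

(** * The rays of the fan of a weighted projective space *)

Section Rays.
Variables (n : nat) (q : n.+1.-tuple nat).
Hypothesis q_gt0 : forall i, (0 < tnth q i)%N.
Local Open Scope nat_scope.

Lemma dgcdS j : dgcd q j.+1 = gcdn (dgcd q j) (nth 0 q j.+1).
Proof. by rewrite /dgcd big_nat_recr. Qed.

Lemma dgcd0 : dgcd q 0 = nth 0 q 0.
Proof. by rewrite /dgcd big_nat1. Qed.

Lemma nth_q_gt0 i : i < n.+1 -> 0 < nth 0 q i.
Proof. by move=> ilt; have := q_gt0 (Ordinal ilt); rewrite (tnth_nth 0). Qed.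

Lemma dgcd_gt0 j : 0 < dgcd q j.
Proof.
elim: j => [|j IH]; first by rewrite dgcd0 nth_q_gt0.
by rewrite dgcdS gcdn_gt0 IH.
Qed.

Lemma smallestP (P : pred nat) : (exists c, P c) -> P (Defs.smallest P).
Proof.
by move=> exP; rewrite /Defs.smallest; case: pselect => // e; case: ex_minnP.
Qed.

Lemma congruence_solvable a b s :
  0 < a -> gcdn a b %| s -> exists c, a %| c * b + s.
Proof.
move=> a0 /dvdnP[t ->]; have [c _ ac] := Bezoutl b a0.
exists (t * c); rewrite -mulnA -mulnDr addnC.
exact: dvdn_mull.
Qed.

Lemma nth_fan_column j k r :
  r <= k -> nth 0 (fan_column q j k) r = nth 0 (fan_column q j (k - r)) 0.
Proof.
elim: k r => [|k IH] [|r] //= rk.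
by rewrite IH // subSS.
Qed.

(** By descent along a column: the greedy choice of the next entry is possible
    because the multiples of q_i generate, modulo d_(0..i-1), the multiples of
    d_(0..i), and the previous partial sum is one of these. *)
Lemma fan_column_dvd j k : k < j ->
  dgcd q (j - k).-1 %|
  \sum_(j - k <= r < j.+1) nth 0 (fan_column q j k) (r - (j - k)) * nth 0 q r.
Proof.
elim: k => [|k IH] kj.
  rewrite subn0 big_nat1 subnn /=; case: j kj => // j _.
  rewrite dgcdS /= -{1}(divnK (dvdn_gcdl (dgcd q j) (nth 0 q j.+1))).
  by rewrite dvdn_mul // dvdn_gcdr.
have kj' := ltnW kj; have {IH} := IH kj'.
have jk : j - k = (j - k.+1).+1 by lia.
have [i iE] : exists i, j - k.+1 = i.+1 by exists (j - k.+1).-1; lia.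
rewrite jk /= iE /= => IH.
have ij : i.+1 < j.+1 by lia.
rewrite big_ltn // subnn /=.
set P := (fun c => _ %| _).
have exP : exists c, P c.
  apply: congruence_solvable; first exact: dgcd_gt0.
  by move: IH; rewrite dgcdS.
have := smallestP exP; rewrite {1}/P /=; congr (_ %| _ + _).
apply: eq_big_nat => r /andP[ir rj].
have -> : r - i.+1 = (r - i.+2).+1 by lia.
by [].
Qed.

Lemma fan_matrix_colE r j : 0 < r <= j ->
  fan_matrix q r j = nth 0 (fan_column q j j.-1) (r - 1).
Proof.
move=> /andP[r0 rj]; rewrite /fan_matrix rj.
rewrite (@nth_fan_column j j.-1 (r - 1)); last by lia.
by have -> : j.-1 - (r - 1) = j - r by lia.
Qed.

(** At the end of the descent the divisor is d_0 = q_0, which makes the division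
    defining v_0 exact. *)
Lemma fan_matrix_col_dvd j : 0 < j <= n ->
  nth 0 q 0 %| \sum_(1 <= r < n.+1) nth 0 q r * fan_matrix q r j.
Proof.
move=> /andP[j0 jn]; rewrite (big_cat_nat (n := j.+1)) //=; try lia.
rewrite [X in _ + X]big1_seq ?addn0; last first.
  move=> r; rewrite mem_index_iota => /andP[_ /andP[jr _]].
  by rewrite /fan_matrix leqNgt jr muln0.
have := @fan_column_dvd j j.-1.
have -> : j - j.-1 = 1 by lia.
rewrite dgcd0 => /(_ ltac:(lia)).
suff -> : \sum_(1 <= r < j.+1) nth 0 (fan_column q j j.-1) (r - 1) * nth 0 q r =
    \sum_(1 <= r < j.+1) nth 0 q r * fan_matrix q r j by [].
apply: eq_big_nat => r /andP[r1 rj].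
by rewrite (@fan_matrix_colE r j) ?r1 // mulnC.
Qed.

Lemma fan_matrix_diag j : 0 < fan_matrix q j.+1 j.+1.
Proof.
rewrite /fan_matrix leqnn subnn /= divn_gt0 ?dgcd_gt0 //.
by rewrite dgcdS dvdn_leq ?dgcd_gt0 // dvdn_gcdl.
Qed.

Local Open Scope ring_scope.

Lemma wps_ray_relation : \sum_i (tnth q i)%:Z *: wps_ray q i = 0.
Proof.
apply/rowP => j; rewrite summxE mxE big_ord_recl !mxE /= (tnth_nth 0%N) /=.
rewrite mulrN -PoszM mulnC divnK; last first.
  by apply: fan_matrix_col_dvd; rewrite /= ltn_ord.
rewrite big_add1 big_mkord /=.
apply/eqP; rewrite addrC subr_eq0; apply/eqP.
rewrite (big_morph Posz PoszD (erefl _)); apply: eq_bigr => i _.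
by rewrite !mxE /= (tnth_nth 0%N) PoszM.
Qed.

(** Subtracting the right multiple of the basic relation leaves a relation between
    v_1, ..., v_n, which is trivial since they are the rows of a triangular
    matrix with positive diagonal. *)
Lemma wps_ray_relations (w : 'I_n.+1 -> rat) :
  \sum_i w i *: map_mx intr (wps_ray q i) = 0 ->
  forall i, (tnth q ord0)%:R * w i = w ord0 * (tnth q i)%:R.
Proof.
move=> w0.
pose u i : rat := (tnth q ord0)%:R * w i - w ord0 * (tnth q i)%:R.
have u0 : u ord0 = 0 by rewrite /u mulrC subrr.
have uv : \sum_i u i *: map_mx intr (wps_ray q i) = 0 :> 'rV[rat]_n.
  under eq_bigr do rewrite /u scalerBl -!scalerA.
  rewrite sumrB -!scaler_sumr w0 scaler0 sub0r.
  have /(congr1 (map_mx (intr : int -> rat))) := wps_ray_relation.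
  rewrite map_mx0 raddf_sum /=; under eq_bigr do rewrite map_mxZ /=.
  by move=> ->; rewrite scaler0 oppr0.
suff uj (j : 'I_n) : u (lift ord0 j) = 0.
  move=> i; apply/eqP; rewrite -subr_eq0; apply/eqP.
  by case: (unliftP ord0 i) => [j ->|->]; [exact: uj|exact: u0].
(* the columns of the triangular matrix give the coefficients one after the
   other *)
have [m] := ubnP (val j); elim: m j => // m IH j jm.
have /rowP/(_ j) := uv; rewrite summxE mxE big_ord_recl mxE u0 mul0r add0r.
rewrite (bigD1 j) //= big1 ?addr0.
  rewrite !mxE /= => /eqP; rewrite mulf_eq0 => /orP[/eqP //|].
  by rewrite intr_eq0 eqz_nat -leqn0 leqNgt fan_matrix_diag.
move=> i ij; rewrite !mxE /=; have [ji|ij'] := ltnP j i.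
  by rewrite /fan_matrix ltnS leqNgt ji mulr0.
by rewrite IH ?mul0r //; apply: (@leq_trans j) => //; rewrite ltn_neqAle ij' andbT.
Qed.
End Rays.

(** * Cones and their duals *)

Section Pairing.
Variable n : nat.
Implicit Types m w : 'rV[int]_n.

Lemma pairingDl m m' w : pairing (m + m') w = pairing m w + pairing m' w.
Proof.
by rewrite /pairing -big_split; apply: eq_bigr => i _; rewrite mxE mulrDl.
Qed.

Lemma pairingZl a m w : pairing (a *: m) w = a * pairing m w.
Proof.
by rewrite /pairing mulr_sumr; apply: eq_bigr => i _; rewrite mxE mulrA.
Qed.

Lemma pairingNl m w : pairing (- m) w = - pairing m w.
Proof. by rewrite -scaleN1r pairingZl mulN1r. Qed.

Lemma pairing0l w : pairing 0 w = 0.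
Proof. by rewrite -(scale0r 0) pairingZl mul0r. Qed.

Lemma pairing_suml (I : Type) (r : seq I) (P : pred I) F w :
  pairing (\sum_(i <- r | P i) F i) w = \sum_(i <- r | P i) pairing (F i) w.
Proof.
apply: (big_morph (fun m => pairing m w)); last exact: pairing0l.
by move=> m m'; exact: pairingDl.
Qed.

Lemma pairingC m w : pairing m w = pairing w m.
Proof. by apply: eq_bigr => i _; rewrite mulrC. Qed.
End Pairing.

Definition proper_cone n (A : {set 'I_n.+1}) (Ap : A \proper [set: 'I_n.+1]%SET) :
  fan n := exist (fun s : {set 'I_n.+1} => s \proper [set: 'I_n.+1]%SET) A Ap.

Section WeightedFan.
Variables (R : realType) (n : nat) (v : 'I_n.+1 -> 'rV[int]_n).
Variable q : 'I_n.+1 -> nat.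
Hypothesis q_gt0 : forall i, (0 < q i)%N.
Hypothesis q_rel : \sum_i (q i)%:Z *: v i = 0.
(* every rational relation between the rays is proportional to q *)
Hypothesis v_rel : forall w : 'I_n.+1 -> rat,
  \sum_i w i *: map_mx intr (v i) = 0 ->
  forall i, (q ord0)%:R * w i = w ord0 * (q i)%:R.
Local Notation C := (Cplx R).
Local Notation X := (toric_variety R v).
Local Notation point := {s : fan n & affine_toric R v s}.
Local Notation P := (point_vector R v).
Implicit Types (s t : fan n) (m : 'rV[int]_n).

(** Any n of the rays are linearly independent, since no q_i vanishes. *)
Lemma v_free k (w : 'I_n.+1 -> rat) :
  \sum_i w i *: map_mx intr (v i) = 0 -> w k = 0 -> forall i, w i = 0.
Proof.
move=> /v_rel wq wk i.
have q_neq0 j : (q j)%:R != 0 :> rat by rewrite pnatr_eq0 -lt0n.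
have /eqP := wq k; rewrite wk mulr0 eq_sym mulf_eq0 (negbTE (q_neq0 k)) orbF.
move=> /eqP w0; have /eqP := wq i; rewrite w0 mul0r mulf_eq0.
by rewrite (negbTE (q_neq0 _)) => /eqP.
Qed.

Lemma pairing_q_rel m : \sum_i (q i)%:Z * pairing m (v i) = 0.
Proof.
transitivity (pairing (\sum_i (q i)%:Z *: v i) m); last by rewrite q_rel pairing0l.
by rewrite pairing_suml; apply: eq_bigr => i _; rewrite pairingZl [in RHS]pairingC.
Qed.

Lemma pairingR_int m w : pairingR m (map_mx intr w) = (pairing m w)%:~R :> R.
Proof.
by rewrite /pairingR rmorph_sum /=; apply: eq_bigr => j _; rewrite mxE rmorphM.
Qed.

Lemma pairingR_cone s m (a : 'I_n.+1 -> R) :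
  pairingR m (\sum_(i in val s) a i *: map_mx intr (v i)) =
  \sum_(i in val s) a i * (pairing m (v i))%:~R.
Proof.
rewrite /pairingR; under eq_bigr do rewrite summxE mulr_sumr.
rewrite exchange_big /=; apply: eq_bigr => i _; rewrite -pairingR_int /pairingR mulr_sumr.
by apply: eq_bigr => j _; rewrite mxE mulrCA.
Qed.

Lemma cone_ray s i : i \in val s -> cone (R := R) v s (map_mx intr (v i)).
Proof.
move=> si; exists (fun j => (j == i)%:R) => [j|]; first by rewrite ler0n.
rewrite (bigD1 i) //= eqxx scale1r big1 ?addr0 // => j /andP[_ /negPf ->].
by rewrite scale0r.
Qed.

Lemma dual_coneP s m :
  dual_cone R v s m <-> forall i, i \in val s -> 0 <= pairing m (v i).
Proof.
split=> [sm i|sm x [a a0 ->]]; first exact: (dual_cone_pairing sm).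
rewrite pairingR_cone; apply: sumr_ge0 => i si.
by rewrite mulr_ge0 // ler0z; exact: sm.
Qed.

Lemma orthogonal_coneP s m :
  orthogonal_cone R v s m <-> forall i, i \in val s -> pairing m (v i) = 0.
Proof.
split=> [sm i si|sm x [a a0 ->]].
  have := sm _ (cone_ray si); rewrite pairingR_int => /eqP.
  by rewrite intr_eq0 => /eqP.
by rewrite pairingR_cone big1 // => i /sm ->; rewrite mulr0.
Qed.

Definition ray_mx k : 'M[int]_n := \matrix_j v (lift k j).

Lemma det_ray_mx k : \det (ray_mx k) != 0.
Proof.
apply/det0P => -[u u0 uB]; case/eqP: u0.
pose w i : rat := if unlift k i is Some j then (u 0 j)%:~R else 0.
have wk : w k = 0 by rewrite /w unlift_none.
have w0 : \sum_i w i *: map_mx intr (v i) = 0.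
  rewrite (bigD1_ord k) //= wk scale0r add0r.
  apply/rowP => l; rewrite summxE mxE.
  have /rowP/(_ l)/(congr1 (intr : int -> rat)) := uB.
  rewrite !mxE rmorph0 rmorph_sum /= => E; rewrite -[RHS]E.
  apply: eq_bigr => j _.
  by rewrite !mxE /w liftK rmorphM.
apply/rowP => j; have := v_free w0 wk (lift k j).
by rewrite /w liftK mxE => /eqP; rewrite intr_eq0 => /eqP.
Qed.

(** The dual basis of the rays other than v_k, multiplied by dual_den to be
    integral. The square of the determinant is taken so that the factor is
    positive. *)
Definition dual_den k : nat := `|\det (ray_mx k) ^+ 2|%N.

Definition dual_vec k i : 'rV[int]_n :=
  if unlift k i is Some j then \det (ray_mx k) *: (col j (\adj (ray_mx k)))^T
  else 0.

Lemma dual_den_gt0 k : (0 < dual_den k)%N.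
Proof. by rewrite absz_gt0 expf_neq0 // det_ray_mx. Qed.

Lemma dual_denE k : (dual_den k)%:Z = \det (ray_mx k) ^+ 2.
Proof. by rewrite gez0_abs // sqr_ge0. Qed.

Lemma pairing_dual_vec k i j : i != k -> j != k ->
  pairing (dual_vec k i) (v j) = (i == j)%:R * (dual_den k)%:Z.
Proof.
rewrite ![_ == k]eq_sym => /unlift_some[i' -> _] /unlift_some[j' -> _].
rewrite /dual_vec liftK pairingZl dual_denE (inj_eq (@lift_inj _ k)).
have /matrixP/(_ j' i') := mul_mx_adj (ray_mx k); rewrite !mxE => E.
have -> : pairing (col i' (\adj (ray_mx k)))^T (v (lift k j')) =
    \det (ray_mx k) *+ (j' == i').
  by rewrite -E; apply: eq_bigr => l _; rewrite !mxE mulrC.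
by rewrite expr2 eq_sym; case: eqP => _; rewrite ?mul1r // mulr0 mul0r.
Qed.

Lemma dual_vec_decomp k m :
  \sum_i pairing m (v i) *: dual_vec k i = (dual_den k)%:Z *: m.
Proof.
rewrite (bigD1_ord k) //= {1}/dual_vec unlift_none scaler0 add0r dual_denE.
apply/rowP => l; rewrite summxE mxE expr2 -mulrA.
have -> : \det (ray_mx k) * m 0 l = (\adj (ray_mx k) *m (ray_mx k *m m^T)) l 0.
  by rewrite mulmxA mul_adj_mx mul_scalar_mx !mxE.
rewrite mxE mulr_sumr; apply: eq_bigr => j _.
rewrite /dual_vec liftK !mxE mulrCA [pairing _ _ * _]mulrC pairingC.
by congr (_ * (_ * _)); apply: eq_bigr => i _; rewrite !mxE.
Qed.

Lemma dual_vec_dual k s i : k \notin val s -> i != k -> dual_cone R v s (dual_vec k i).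
Proof.
move=> ks ik; apply/dual_coneP => j js.
have jk : j != k by apply: contraNneq ks => <-.
by rewrite pairing_dual_vec // mulr_ge0 ?ler0n.
Qed.

(** A face t of s is cut out by a linear form c of the dual cone of s, and c can be
    taken arbitrarily large on the other rays of s. *)
Lemma separating s t (B : nat) : val t \subset val s -> exists c,
  [/\ dual_cone R v s c, orthogonal_cone R v t c &
      forall i, i \in val s -> i \notin val t -> B%:Z <= pairing c (v i)].
Proof.
move=> ts; have /properP[_ [k _ ks]] := valP s.
have neqk j : j \in val s -> j != k by apply: contraTneq => ->.
exists (B%:Z *: \sum_(i in val s | i \notin val t) dual_vec k i).
have cE j : j \in val s ->
    pairing (B%:Z *: \sum_(i in val s | i \notin val t) dual_vec k i) (v j) =
    if j \in val t then 0 else B%:Z * (dual_den k)%:Z.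
  move=> js; rewrite pairingZl pairing_suml; case: ifPn => jt.
    rewrite big1 ?mulr0 // => i /andP[si it]; rewrite pairing_dual_vec ?neqk //.
    by case: eqVneq => [ij|]; rewrite ?mul0r //; rewrite ij jt in it.
  rewrite (bigD1 j) /= ?js // pairing_dual_vec ?neqk // eqxx mul1r big1 ?addr0 //.
  move=> i /andP[/andP[si _] ij]; rewrite pairing_dual_vec ?neqk //.
  by rewrite (negbTE ij) mul0r.
split.
- by apply/dual_coneP => j js; rewrite cE //; case: ifP => // _; rewrite mulr_ge0 ?ler0n.
- by apply/orthogonal_coneP => j jt; rewrite (cE _ (fintype.subsetP ts _ jt)) jt.
- move=> j js jt; rewrite cE // (negbTE jt) ler_peMr ?ler0n //.
  by have := dual_den_gt0 k; lia.
Qed.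

(** * Homogeneous coordinates on the toric variety *)

(** The value at m of the torus character with coordinates z. Integer powers are
    total, but the powers of 0 have the intended meaning only for exponents >= 0,
    that is, for m in the dual of a cone containing zeros z. *)
Definition monomial (z : 'I_n.+1 -> C) m : C := \prod_i z i ^ pairing m (v i).

Definition zeros (z : 'I_n.+1 -> C) : {set 'I_n.+1} := [set i | z i == 0].

Lemma monomial0 z : monomial z 0 = 1.
Proof. by rewrite /monomial big1 // => i _; rewrite pairing0l expr0z. Qed.

Lemma monomialD z s m m' : zeros z \subset val s ->
  dual_cone R v s m -> dual_cone R v s m' ->
  monomial z (m + m') = monomial z m * monomial z m'.
Proof.
move=> zs /dual_coneP sm /dual_coneP sm'; rewrite /monomial -big_split /=.
apply: eq_bigr => i _; rewrite pairingDl; have [zi|zi] := eqVneq (z i) 0.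
  by rewrite exprzD_ss // sm ?sm' //; apply: (fintype.subsetP zs); rewrite inE zi.
by rewrite expfzDr.
Qed.

Lemma monomial_neq0 z s m : zeros z \subset val s -> orthogonal_cone R v s m ->
  monomial z m != 0.
Proof.
move=> zs /orthogonal_coneP sm; apply/prodf_neq0 => i _.
have [zi|zi] := eqVneq (z i) 0; last exact: expfz_neq0.
by rewrite sm ?expr0z ?oner_neq0 //; apply: (fintype.subsetP zs); rewrite inE zi.
Qed.

Lemma monomial_eq0 z s m i : zeros z \subset val s -> dual_cone R v s m ->
  i \in zeros z -> pairing m (v i) != 0 -> monomial z m = 0.
Proof.
move=> zs /dual_coneP sm zi mi; rewrite /monomial (bigD1 i) //=.
by move: zi; rewrite inE => /eqP ->; rewrite exp0rz (negbTE mi) mul0r.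
Qed.

Definition homogeneous z (x : point) :=
  zeros z \subset val (tag x) /\
  forall m : set_type (dual_cone R v (tag x)), val (tagged x) m = monomial z (val m).

Definition dual_elt s m (sm : dual_cone R v s m) : set_type (dual_cone R v s) :=
  exist _ m (mem_set sm).

Lemma affine1 s (f : affine_toric R v s) m (sm : dual_cone R v s m) :
  m = 0 -> val f (dual_elt sm) = 1.
Proof. by move=> m0; have [f1 _] := set_valP f; exact: f1. Qed.

Lemma affineM s (f : affine_toric R v s) m m' m'' (sm : dual_cone R v s m)
    (sm' : dual_cone R v s m') (sm'' : dual_cone R v s m'') : m'' = m + m' ->
  val f (dual_elt sm'') = val f (dual_elt sm) * val f (dual_elt sm').
Proof. by move=> m0; have [_ fM] := set_valP f; exact: fM. Qed.

Definition monomial_fun s z : {ptws set_type (dual_cone R v s) -> C} :=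
  fun m : set_type (dual_cone R v s) => monomial z (val m).

Fact homogeneous_hom s z : zeros z \subset val s ->
  @monomial_fun s z \in @semigroup_hom R n v s.
Proof.
move=> zs; rewrite inE /monomial_fun.
split=> [m ->|m m' m'' ->]; first exact: monomial0.
by apply: monomialD zs _ _; exact: set_valP.
Qed.

Definition affine_point s z (zs : zeros z \subset val s) : affine_toric R v s :=
  exist (fun f => f \in @semigroup_hom R n v s) _ (homogeneous_hom zs).

Lemma homogeneous_affine_point s z (zs : zeros z \subset val s) :
  homogeneous z (existT _ s (affine_point zs)).
Proof. by split. Qed.

(** Restriction to a larger cone s of a homomorphism f on the dual of a face t loses
    nothing: choosing c in the dual of s vanishing on t, the value f(c) is
    invertible, which forces zeros z to lie in t, and for large c every m in the
    dual of t is the difference of m + c and c, both in the dual of s. *)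
Lemma glue_homogeneous (x y : point) z :
  Defs.glue x y -> homogeneous z x <-> homogeneous z y.
Proof.
case: x y => [t f] [s h] [ts' fh']; have {ts'}ts : val t \subset val s := ts'.
have fh (m : set_type (dual_cone R v t)) (m' : set_type (dual_cone R v s)) :
  val m = val m' -> val f m = val h m' := fh' m m'.
have hom_affine (r : fan n) (g : affine_toric R v r) : homogeneous z (existT _ r g) <->
  zeros z \subset val r /\
  forall m : set_type (dual_cone R v r), val g m = monomial z (val m) by [].
rewrite !hom_affine.
have st m : dual_cone R v s m -> dual_cone R v t m.
  move=> /dual_coneP sm; apply/dual_coneP => i it; apply: sm.
  exact: fintype.subsetP ts _ it.
split=> -[zs fz].
  split=> [|m]; first exact: fintype.subset_trans zs ts.
  have sm : dual_cone R v s (val m) by exact: set_valP.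
  exact: etrans (esym (fh (dual_elt (st _ sm)) m erefl)) (fz _).
have hz m (sm : dual_cone R v s m) : val f (dual_elt (st _ sm)) = monomial z m.
  by rewrite (fh _ (dual_elt sm)) // fz.
have zt : zeros z \subset val t.
  have [c [sc tc cgt]] := separating 1 ts.
  have tNc : dual_cone R v t (- c).
    apply/dual_coneP => i ti; rewrite pairingNl.
    by move/orthogonal_coneP: tc => /(_ i ti) ->; rewrite oppr0.
  have t0 : dual_cone R v t 0 by apply/dual_coneP => i _; rewrite pairing0l.
  have := @affineM _ f c (- c) 0 (st _ sc) tNc t0; rewrite subrr => /(_ erefl).
  rewrite affine1 // hz => /eqP E; apply/fintype.subsetP => i zi; apply: contraT => it.
  have si := fintype.subsetP zs _ zi; have ci := cgt _ si it.
  rewrite (monomial_eq0 zs sc zi) ?mul0r ?oner_eq0 // in E.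
  by apply: contraTneq ci => ->.
split=> // m; have tm : dual_cone R v t (val m) by exact: set_valP.
have [c [sc tc cgt]] := separating (\sum_i `|pairing (val m) (v i)|) ts.
have smc : dual_cone R v s (val m + c).
  apply/dual_coneP => i si; rewrite pairingDl; case: (boolP (i \in val t)) => ti.
    by move/orthogonal_coneP: tc => /(_ i ti) ->; rewrite addr0 (dual_cone_pairing tm).
  (* c was taken at least as large as all the coordinates of m *)
  have := cgt _ si ti.
  have : (`|pairing (val m) (v i)| <= \sum_i `|pairing (val m) (v i)|)%N.
    by rewrite (bigD1 i) //= leq_addr.
  lia.
have := @affineM _ f (val m) c _ tm (st _ sc) (st _ smc) erefl.
rewrite !hz (monomialD zt tm (st _ sc)) => E.
have -> : m = dual_elt tm by apply: val_inj.
by apply: (mulIf (monomial_neq0 zt tc)); rewrite -E.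
Qed.

Lemma toric_pi_eq (x y : point) : toric_pi x = toric_pi y <-> glued x y.
Proof. by split=> [/eqmodP|xy]; [|apply/eqmodP]. Qed.

(** The gluing relation is generated by glue, and homogeneous coordinates are
    preserved in both directions. *)
Lemma toric_pi_homogeneous (x y : point) z :
  toric_pi x = toric_pi y -> homogeneous z x -> homogeneous z y.
Proof.
move=> /toric_pi_eq /asboolP xy.
suff : homogeneous z x <-> homogeneous z y by case.
elim: xy => {x y} [x y /glue_homogeneous //|//|x y _ [] //|x y w _ xy _ yw].
by rewrite xy.
Qed.

Lemma zeros_proper z (s : fan n) :
  zeros z \subset val s -> zeros z \proper [set: 'I_n.+1]%SET.
Proof. by move=> zs; apply: sub_proper_trans zs (valP s). Qed.

(** Both points are glued to the point with coordinates z in the chart of the cone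
    zeros z, the smallest chart where it is defined. *)
Lemma homogeneous_toric_pi (x y : point) z :
  homogeneous z x -> homogeneous z y -> toric_pi x = toric_pi y.
Proof.
move=> zx zy; have zp := zeros_proper zx.1.
pose t : fan n := proper_cone zp.
have zt : zeros z \subset val t by [].
suff E w : homogeneous z w -> toric_pi (existT _ t (affine_point zt)) = toric_pi w.
  by rewrite -(E x) // -(E y).
move=> zw; apply/toric_pi_eq/asboolP/rst_step; split; first exact: zw.1.
by move=> m m' mm; rewrite zw.2 -mm.
Qed.

Definition coords z (p : X) := exists2 x, p = toric_pi x & homogeneous z x.

Lemma coordsE z (x : point) : coords z (toric_pi x) <-> homogeneous z x.
Proof.
split=> [[y yx zy]|zx]; last by exists x.
by apply: toric_pi_homogeneous zy.
Qed.

Lemma coords_inj z p p' : coords z p -> coords z p' -> p = p'.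
Proof. by move=> [x -> zx] [y -> zy]; exact: homogeneous_toric_pi zx zy. Qed.

Lemma coords_ex z (s : fan n) : zeros z \subset val s -> exists p, coords z p.
Proof.
move=> zs; exists (toric_pi (existT _ s (affine_point zs))).
by exists (existT _ s (affine_point zs)).
Qed.

(** * Topology of the charts and orbits *)

Lemma affine_eval_continuous (s : fan n) (m : set_type (dual_cone R v s)) :
  continuous (fun f : affine_toric R v s => val f m).
Proof.
move=> f B fB.
have pc := @proj_continuous (set_type (dual_cone R v s)) (fun _ => C) m (val f).
have ic := @initial_continuous (affine_toric R v s) _
  (val : affine_toric R v s -> {ptws set_type (dual_cone R v s) -> C}) f.
exact: (ic _ (pc _ fB)).
Qed.

Lemma affine_eval_ball (s : fan n) (m : set_type (dual_cone R v s))
    (f0 : affine_toric R v s) :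
  nbhs f0 [set f | ball (val f0 m) 1 (val f m)].
Proof.
have nb : nbhs (val f0 m) (ball (val f0 m) 1) by exact: nbhsx_ballx.
have ec := @affine_eval_continuous s m f0.
by have := ec _ nb; rewrite nbhs_simpl.
Qed.

Lemma affine_continuous (T : topologicalType) (s : fan n) (g : T -> affine_toric R v s) :
  (forall m : set_type (dual_cone R v s), continuous (fun u : T => val (g u) m)) ->
  continuous g.
Proof.
move=> gc; apply: continuous_comp_initial => u; apply/cvg_sup => m.
apply: continuous_comp_initial; exact: gc.
Qed.

Lemma affine_hausdorff (s : fan n) : hausdorff_space (affine_toric R v s).
Proof.
apply: (@separated_hausdorff _ C); first exact: norm_hausdorff.
move=> f g fg; have [m fgm] : exists m : set_type (dual_cone R v s), val f m <> val g m.
  by apply/existsNP => E; apply: fg; apply: val_inj; apply/funext.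
by exists (fun f : affine_toric R v s => val f m); first exact: affine_eval_continuous.
Qed.

Lemma toric_pi_continuous (s : fan n) :
  continuous (fun f : affine_toric R v s => toric_pi (existT _ s f)).
Proof.
move=> f; apply: continuous_comp; first exact: existT_continuous.
exact: pi_continuous.
Qed.

(** The rays of a maximal cone generate only a sublattice of finite index, so the
    coordinates are obtained from the values of the character by extracting roots of order
    dual_den. *)
Lemma character_monomial (t : 'rV[int]_n -> C) :
  t 0 = 1 -> (forall m m', t (m + m') = t m * t m') ->
  exists y : 'I_n.+1 -> C, (forall i, y i != 0) /\ forall m, t m = monomial y m.
Proof.
move=> t0 tD; pose k : 'I_n.+1 := ord0; have D0 := dual_den_gt0 k.
pose tau l : C := (dual_den k).-root (t (delta_mx 0 l)).
have tauE l : tau l ^+ dual_den k = t (delta_mx 0 l) by exact: rootCK.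
have tn0 u : t u != 0.
  have uE : t u * t (- u) = 1 by rewrite -tD subrr.
  by apply: contra_eq_neq uE => ->; rewrite mul0r eq_sym oner_neq0.
have tau0 l : tau l != 0.
  by have := tn0 (delta_mx 0 l); rewrite -tauE expf_eq0 D0.
exists (fun i => \prod_l tau l ^ dual_vec k i 0 l); split=> [i|m].
  by apply/prodf_neq0 => l _; exact: expfz_neq0.
rewrite (character_prod t0 tD) /monomial.
transitivity (\prod_l \prod_i tau l ^ (dual_vec k i 0 l * pairing m (v i))).
  apply: eq_bigr => l _; rewrite exprz_sum // -tauE exprnP exprz_exp.
  have /rowP/(_ l) := dual_vec_decomp k m; rewrite summxE !mxE => <-.
  by congr (_ ^ _); apply: eq_bigr => i _; rewrite !mxE mulrC.
rewrite exchange_big /=; apply: eq_bigr => i _.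
elim/big_rec2: _ => [|l a b _ ->]; first by rewrite exp1rz.
by rewrite expfzMl -exprz_exp.
Qed.

(** The character defining a point of the orbit is given by nonzero coordinates, of
    which those on s are then replaced by 0; conversely, coordinates with zero set
    s define a character. *)
Lemma torus_orbitP (s : fan n) (p : X) :
  torus_orbit s p <-> exists z, zeros z = val s /\ coords z p.
Proof.
split=> [[t [f [[t0 tD] fE ->]]]|[z [zs zp]]].
  have [y [y0 yE]] := character_monomial t0 tD.
  pose z i := if i \in val s then 0 else y i.
  have zs : zeros z = val s.
    apply/setP => i; rewrite inE /z; case: (i \in val s); first by rewrite eqxx.
    by rewrite (negbTE (y0 i)).
  have zs' : zeros z \subset val s by rewrite zs.
  exists z; split=> //; apply/coordsE; split; first exact: zs'.
  move=> m /=; rewrite fE; have sm : dual_cone R v s (val m) by exact: set_valP.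
  case: asboolP => [/orthogonal_coneP om|om].
    rewrite yE /monomial; apply: eq_bigr => i _; rewrite /z.
    by case: ifP => // /om ->; rewrite !expr0z.
  have [i [si mi]] : exists i, i \in val s /\ pairing (val m) (v i) <> 0.
    apply: contrapT => H; apply: om; apply/orthogonal_coneP => i si.
    by apply: contrapT => mi; apply: H; exists i.
  apply/esym; apply: (monomial_eq0 zs' sm (i := i)); first by rewrite zs.
  exact/eqP.
have zs' : zeros z \subset val s by rewrite zs.
(* the character must be defined on the whole lattice: the coordinates that
   vanish, which do not matter on the orthogonal of s, are replaced by 1 *)
pose z' i := if i \in val s then 1 else z i.
have z'0 i : z' i != 0.
  rewrite /z'; case: ifP => si; first exact: oner_neq0.
  by have /setP/(_ i) := zs; rewrite inE si => ->.
exists (monomial z'), (affine_point zs'); split.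
- split=> [|m m']; first exact: monomial0.
  rewrite /monomial -big_split; apply: eq_bigr => i _ /=.
  by rewrite pairingDl expfzDr.
- move=> m; have sm : dual_cone R v s (val m) by exact: set_valP.
  case: asboolP => [/orthogonal_coneP om|om].
    rewrite [LHS]/= /monomial_fun; apply: eq_bigr => i _; rewrite /z'.
    by case: ifP => // /om ->; rewrite !expr0z.
  have [i [si mi]] : exists i, i \in val s /\ pairing (val m) (v i) <> 0.
    apply: contrapT => H; apply: om; apply/orthogonal_coneP => i si.
    by apply: contrapT => mi; apply: H; exists i.
  apply: (monomial_eq0 zs' sm (i := i)); first by rewrite zs.
  exact/eqP.
- apply: (coords_inj zp); apply/coordsE; exact: homogeneous_affine_point.
Qed.

Definition chart_coords (k : 'I_n.+1) (x : 'rV[C]_n) (i : 'I_n.+1) : C :=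
  if unlift k i is Some j then x 0 j else 1.

Definition chart_elt k (x : 'rV[C]_n) : affine_toric R v (max_cone k) :=
  exist (fun f => f \in @semigroup_hom R n v (max_cone k)) _ (chart_hom_subproof v k x).

Lemma chart_eltE k x : chart v k x = toric_pi (existT _ (max_cone k) (chart_elt k x)).
Proof. by []. Qed.

Lemma chart_coords_lift k x j : chart_coords k x (lift k j) = x 0 j.
Proof. by rewrite /chart_coords liftK. Qed.

Lemma chart_coords_id k x : chart_coords k x k = 1.
Proof. by rewrite /chart_coords unlift_none. Qed.

Lemma zeros_chart k x : zeros (chart_coords k x) \subset val (max_cone k).
Proof.
apply/fintype.subsetP => i; rewrite !inE; apply: contraTneq => ->.
by rewrite chart_coords_id oner_eq0.
Qed.

Lemma chart_elt_monomial k x (m : set_type (dual_cone R v (max_cone k))) :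
  val (chart_elt k x) m = monomial (chart_coords k x) (val m).
Proof.
rewrite /monomial (bigD1_ord k) //= chart_coords_id exp1rz mul1r.
apply: eq_bigr => j _; rewrite chart_coords_lift.
have m0 : 0 <= pairing (val m) (v (lift k j)).
  apply: (@dual_cone_pairing R _ _ (max_cone k)); first exact: set_valP.
  by rewrite !inE eq_sym neq_lift.
by rewrite -{2}(gez0_abs m0).
Qed.

Lemma chart_homogeneous k x :
  homogeneous (chart_coords k x) (existT _ (max_cone k) (chart_elt k x)).
Proof. by split; [exact: zeros_chart|exact: chart_elt_monomial]. Qed.

Lemma coords_chart k x : coords (chart_coords k x) (chart v k x).
Proof.
by exists (existT _ (max_cone k) (chart_elt k x)) => //; exact: chart_homogeneous.
Qed.

(** Coordinates with z_k != 0 can be normalized to z_k = 1: multiplying each z_i by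
    mu^(q_i) does not change the point because of the relation between the rays. *)
Lemma homogeneous_chart k (f : affine_toric R v (max_cone k)) z :
  homogeneous z (existT _ (max_cone k) f) ->
  exists2 x, f = chart_elt k x & forall j, (x 0 j == 0) = (z (lift k j) == 0).
Proof.
move=> [zk fz].
have zk0 : z k != 0.
  by apply: contraTneq zk => zk; apply/fintype.subsetPn; exists k; rewrite !inE ?zk ?eqxx.
pose mu : C := (q k).-root (z k)^-1.
have muE : mu ^+ q k = (z k)^-1 by exact: rootCK.
have mu0 : mu != 0.
  by have := invr_neq0 zk0; rewrite -muE expf_eq0 q_gt0.
pose x : 'rV[C]_n := \row_j (mu ^+ q (lift k j) * z (lift k j)).
exists x; last by move=> j; rewrite mxE mulf_eq0 expf_eq0 (negbTE mu0) andbF.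
apply: val_inj; apply/funext => m.
rewrite chart_elt_monomial (fz m).
have xE i : chart_coords k x i = mu ^+ q i * z i.
  case: (unliftP k i) => [j ->|->]; first by rewrite chart_coords_lift mxE.
  by rewrite chart_coords_id muE mulVf.
rewrite /monomial; under [RHS]eq_bigr do rewrite xE expfzMl exprnP exprz_exp.
by rewrite big_split /= exprz_sum // pairing_q_rel // expr0z mul1r.
Qed.

Lemma coords_to_chart z (p : X) k : coords z p -> z k != 0 ->
  exists2 x, p = chart v k x & forall j, (x 0 j == 0) = (z (lift k j) == 0).
Proof.
move=> zp zk.
have zs : zeros z \subset val (max_cone k).
  by apply/fintype.subsetP => i; rewrite !inE; apply: contraTneq => ->.
have H := homogeneous_affine_point zs.
have [x fx xz] := homogeneous_chart H; exists x => //.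
rewrite chart_eltE -fx; apply: (coords_inj zp); exact/coordsE.
Qed.

Lemma toric_pi_chart k (f : affine_toric R v (max_cone k)) z :
  coords z (toric_pi (existT _ (max_cone k) f)) ->
  exists2 x, f = chart_elt k x & forall j, (x 0 j == 0) = (z (lift k j) == 0).
Proof. by move=> /coordsE; exact: homogeneous_chart. Qed.

Lemma coords_neq0 z (p : X) : coords z p -> exists k, z k != 0.
Proof.
move=> [x _ [/zeros_proper/properP[_ [k _ zk]] _]]; exists k.
by rewrite inE in zk.
Qed.

Lemma chart_elt_continuous k : continuous (chart_elt k).
Proof.
apply: affine_continuous => m; apply: prod_continuous => j.
by apply: expr_continuous; exact: coord_continuous.
Qed.

Lemma chart_continuous k : continuous (@chart R n v k).
Proof.
move=> x B /toric_pi_continuous fB.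
exact: (@chart_elt_continuous k x _ fB).
Qed.

(** The chart is proper: near a given f0, the values f(m_j) = x_j^D are bounded, so
    the preimage lies in a compact box, whose image is compact, hence closed. *)
Lemma chart_elt_closed k (F : set 'rV[C]_n) : closed F -> closed (chart_elt k @` F).
Proof.
move=> cF f0 f0F; have D0 := dual_den_gt0 k.
have dm j : dual_cone R v (max_cone k) (dual_vec k (lift k j)).
  apply: dual_vec_dual; last by rewrite eq_sym neq_lift.
  by rewrite !inE eqxx.
pose c j := val f0 (dual_elt (dm j)).
pose M j : C := 1 + (1 + `|c j|).
have /choice [A AP] : forall j, exists A : set C,
    compact A /\ forall z, `|z| <= M j -> A z.
  move=> j; have [|A ? ?] := @disc_in_compact R (M j); last by exists A.
  by rewrite !rpredD // ?real1 // normr_real.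
pose K := [set x : 'rV[C]_n | forall j, A j (x ord0 j)] `&` F.
have cK : closed (chart_elt k @` K).
  apply: compact_closed; first exact: affine_hausdorff.
  apply: continuous_compact; first exact/continuous_subspaceT/chart_elt_continuous.
  apply: compact_closedI => //; apply: rV_compact => j; exact: (AP j).1.
have : closure (chart_elt k @` K) f0; last first.
  by move/cK => [x [_ Fx] <-]; exists x.
move=> B nB.
have : nbhs f0 (B `&` [set f | forall j, ball (c j) 1 (val f (dual_elt (dm j)))]).
  apply: filterI => //.
  apply: (@filter_forall _ _ (fun j f => ball (c j) 1 (val f (dual_elt (dm j))))
    (nbhs f0) _) => j.
  exact: affine_eval_ball.
move/f0F => [f [[x Fx xf] [Bf fc]]]; exists f; split=> //; exists x => //; split=> // j.
apply: (AP j).2; rewrite /M; apply: (norm_exp_le D0).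
have -> : `|x ord0 j| ^+ dual_den k = `|val f (dual_elt (dm j))|.
  rewrite -xf chart_elt_monomial /monomial (bigD1_ord k) //= chart_coords_id exp1rz mul1r.
  rewrite (bigD1 j) //= chart_coords_lift pairing_dual_vec ?eqxx; last 2 first.
  - by rewrite eq_sym neq_lift.
  - by rewrite eq_sym neq_lift.
  rewrite mul1r big1 ?mulr1; first by rewrite -exprnP normrX.
  move=> i ij; rewrite pairing_dual_vec; last 2 first.
  - by rewrite eq_sym neq_lift.
  - by rewrite eq_sym neq_lift.
  by rewrite (inj_eq lift_inj) eq_sym (negbTE ij) mul0r expr0z.
have := fc j; rewrite -ball_normE /= => cf.
rewrite -[X in `|X|](subrK (c j)) (le_trans (ler_normD _ _)) // lerD2r.
by rewrite distrC ltW.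
Qed.

Section Restriction.
Variables (s t : fan n) (st : val s \subset val t).

Lemma dual_coneS m : dual_cone R v t m -> dual_cone R v s m.
Proof.
move=> /dual_coneP tm; apply/dual_coneP => i si; apply: tm.
exact: fintype.subsetP st _ si.
Qed.

Definition restrict_fun (f : affine_toric R v s) :
    {ptws set_type (dual_cone R v t) -> C} :=
  fun m : set_type (dual_cone R v t) => val f (dual_elt (dual_coneS (set_valP m))).

Fact restrict_hom f : restrict_fun f \in @semigroup_hom R n v t.
Proof.
rewrite inE; split=> [m m0|m m' m'' mE]; first exact: affine1.
exact: affineM.
Qed.

Definition restrict f : affine_toric R v t :=
  exist (fun f => f \in @semigroup_hom R n v t) _ (restrict_hom f).

Lemma restrict_continuous : continuous restrict.
Proof. by apply: affine_continuous => m; exact: affine_eval_continuous. Qed.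

Lemma toric_pi_restrict f :
  toric_pi (existT _ s f) = toric_pi (existT _ t (restrict f)).
Proof.
apply/toric_pi_eq/asboolP/rst_step; split=> //= m m' mm.
by congr (sval f _); apply: val_inj.
Qed.
End Restriction.

Lemma max_cone_sup (s : fan n) :
  exists2 k, k \notin val s & val s \subset val (max_cone k).
Proof.
have /properP[_ [k _ ks]] := valP s; exists k => //.
by apply/fintype.subsetP => i si; rewrite !inE; apply: contraNneq ks => <-.
Qed.

(** The affine variety of a smaller cone maps continuously to that of a maximal cone
    containing it, so closedness may be tested on the maximal cones. *)
Lemma closed_charts (E : set X) :
  (forall k, closed [set f : affine_toric R v (max_cone k) |
     E (toric_pi (existT _ (max_cone k) f))]) -> closed E.
Proof.
move=> cE; rewrite -openC; apply/sigT_openP => s.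
rewrite -[X in open X]setCK openC.
have [k _ sk] := max_cone_sup s.
rewrite (_ : ~` _ = restrict sk @^-1` [set f : affine_toric R v (max_cone k) |
     E (toric_pi (existT _ (max_cone k) f))]).
  by apply: preimage_closed => // f _; exact: restrict_continuous.
by apply/seteqP; split=> f /=; rewrite notK -toric_pi_restrict.
Qed.

(** The point lives in the chart of the cone zeros z, and all its homogeneous
    coordinates vanish at most there. *)
Lemma coords_zeros z z' (p : X) : coords z p -> coords z' p -> zeros z = zeros z'.
Proof.
suff sub y y' : coords y p -> coords y' p -> zeros y' \subset zeros y.
  by move=> zp z'p; apply/eqP; rewrite finset.eqEsubset !sub.
move=> yp y'p; have [x _ [ys _]] := yp; have yt := zeros_proper ys.
pose t : fan n := proper_cone yt.
have yt' : zeros y \subset val t by [].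
have pE : p = toric_pi (existT _ t (affine_point yt')).
  by apply: (coords_inj yp); eexists; [reflexivity|exact: homogeneous_affine_point].
by move: y'p; rewrite pE => /coordsE[].
Qed.

Definition orbit_closure (s : fan n) : set X :=
  [set p | exists2 z, val s \subset zeros z & coords z p].

Lemma orbit_closure_coords s z (p : X) :
  coords z p -> orbit_closure s p <-> val s \subset zeros z.
Proof.
move=> zp; split=> [[z' sz' z'p]|sz]; last by exists z.
by rewrite (coords_zeros zp z'p).
Qed.

(** A maximal cone not containing s does not meet the orbit closure; on the others
    the trace of E is the image of a closed set by a closed map. *)
Lemma closed_in_orbit_closure (s : fan n) (E : set X) : E `<=` orbit_closure s ->
  (forall k, k \notin val s -> closed [set x | E (chart v k x)]) -> closed E.
Proof.
move=> Es cE; apply: closed_charts => k; have [sk|sk] := boolP (k \in val s).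
  rewrite (_ : [set f | _] = set0); first exact: closed0.
  apply/seteqP; split=> f //= /Es[z sz /coordsE[zk _]].
  have := fintype.subsetP (fintype.subset_trans sz zk) _ sk.
  by rewrite !inE eqxx.
rewrite (_ : [set f | _] = chart_elt k @` [set x | E (chart v k x)]).
  by apply: chart_elt_closed; exact: cE.
apply/seteqP; split=> f /=; last by move=> [x Ex <-].
move=> Ef; have [z sz zf] := Es _ Ef.
by have [x fx _] := toric_pi_chart zf; exists x; rewrite -?fx //; move: Ef; rewrite fx.
Qed.

Lemma orbit_closure_chart (s : fan n) k x :
  orbit_closure s (chart v k x) <->
  k \notin val s /\ forall j, lift k j \in val s -> x 0 j = 0.
Proof.
rewrite (orbit_closure_coords _ (coords_chart k x)); split=> [sz|[ks sz]].
  split=> [|j js].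
    by apply/negP => /(fintype.subsetP sz); rewrite inE chart_coords_id oner_eq0.
  by have := fintype.subsetP sz _ js; rewrite inE chart_coords_lift => /eqP.
apply/fintype.subsetP => i si; rewrite inE.
case: (unliftP k i) => [j ij|ik]; last by rewrite -ik si in ks.
by rewrite ij chart_coords_lift sz ?eqxx // -ij.
Qed.

Lemma orbit_closure_closed (s : fan n) : closed (orbit_closure s).
Proof.
apply: (@closed_in_orbit_closure s) => // k ks.
rewrite (_ : [set x | _] =
  \bigcap_(j in [set j : 'I_n | lift k j \in val s])
    (fun x : 'rV[C]_n => x 0 j) @^-1` [set 0]).
  apply: closed_bigI => j _; apply: preimage_closed.
    by move=> x _; exact: coord_continuous.
  exact/accessible_closed_set1/hausdorff_accessible/norm_hausdorff.
apply/seteqP; split=> x /=; first by move=> /orbit_closure_chart[_ xs] j /xs.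
by move=> xs; apply/orbit_closure_chart; split=> // j js; exact: xs.
Qed.

(** A point of the stratum is approached inside the open orbit by replacing its
    other vanishing coordinates by a small nonzero number. *)
Lemma closure_torus_orbit (s : fan n) :
  closure (@torus_orbit R n v s) = orbit_closure s.
Proof.
apply/seteqP; split.
  rewrite [X in _ `<=` X](closure_id _).1; last exact: orbit_closure_closed.
  apply: closure_subset => p /torus_orbitP[z [zs zp]].
  by exists z => //; rewrite zs.
move=> p [z sz zp]; have [k zk] := coords_neq0 zp.
have [x -> xz] := coords_to_chart zp zk.
pose y (t : C) : 'rV[C]_n :=
  \row_j if (x 0 j == 0) && (lift k j \notin val s) then t else x 0 j.
have yc : continuous y.
  apply: row_continuous => j t B; rewrite mxE => tB.
  have -> : (fun u => y u 0 j) =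
      (fun u => if (x 0 j == 0) && (lift k j \notin val s) then u else x 0 j).
    by apply/funext => u; rewrite mxE.
  by move: tB; case: ifP => _ // tB; exact: (cst_continuous tB).
have y0 : y 0 = x.
  by apply/rowP => j; rewrite mxE; case: ifP => // /andP[/eqP -> _].
move=> B nB.
have : nbhs (0 : C) ((chart v k \o y) @^-1` B).
  have nB' : nbhs (chart v k (y 0)) B by rewrite y0.
  by have := yc 0 _ (@chart_continuous k _ _ nB'); rewrite nbhs_simpl.
move=> /nbhs_ballP[e /= e0 eB]; exists (chart v k (y (e / 2))); split; last first.
  apply: eB; rewrite -ball_normE /= sub0r normrN gtr0_norm ?divr_gt0 //.
  by rewrite ltr_pdivrMr // ltr_pMr // ltr1n.
apply/torus_orbitP; exists (chart_coords k (y (e / 2))).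
split; last exact: coords_chart.
apply/setP => i; rewrite inE; case: (unliftP k i) => [j ->|->]; last first.
  rewrite chart_coords_id oner_eq0; apply/esym/negP => /(fintype.subsetP sz).
  by rewrite inE (negbTE zk).
rewrite chart_coords_lift mxE; have [x0|x0] := eqVneq (x 0 j) 0 => /=.
  by case: ifPn => ks; rewrite ?x0 ?eqxx ?(negPn ks) // gt_eqF ?divr_gt0 // (negbTE ks).
rewrite (negbTE x0); apply/esym/negP => /(fintype.subsetP sz).
by rewrite inE -xz (negbTE x0).
Qed.

(** * Box coordinates and local groups *)

Definition extend (s : fan n) (a : 'I_n.+1 -> rat) i : rat :=
  if i \in val s then a i else 0.

Lemma coordinates_extend s a g :
  coordinates v s a g <-> map_mx intr g = \sum_i extend s a i *: map_mx intr (v i).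
Proof.
rewrite /coordinates big_mkcond /=.
suff -> : \sum_i (if i \in \val s then a i *: map_mx intr (v i) else 0) =
  \sum_i extend s a i *: map_mx intr (v i) :> 'rV[rat]_n by [].
by apply: eq_bigr => i _; rewrite /extend; case: ifP; rewrite ?scale0r.
Qed.

(** The relative interiors of the cones are disjoint: the difference of two families
    of coordinates is a multiple of (q_i), hence of constant sign, while each of
    the families vanishes somewhere. *)
Lemma nonneg_coordinates_unique (s s' : fan n) (a a' : 'I_n.+1 -> rat) g :
  (forall i, i \in val s -> 0 <= a i) -> (forall i, i \in val s' -> 0 <= a' i) ->
  coordinates v s a g -> coordinates v s' a' g -> extend s a =1 extend s' a'.
Proof.
move=> a0 a'0 /coordinates_extend ga /coordinates_extend ga'.
pose d i := extend s a i - extend s' a' i.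
have d_rel : \sum_i d i *: map_mx intr (v i) = 0.
  by under eq_bigr do rewrite scalerBl; rewrite sumrB -ga -ga' subrr.
have dq := v_rel d_rel.
have qp i : 0 < (q i)%:R :> rat by rewrite ltr0n.
have d0 : d ord0 = 0.
  have e0 i : 0 <= extend s a i by rewrite /extend; case: ifP => // /a0.
  have e'0 i : 0 <= extend s' a' i by rewrite /extend; case: ifP => // /a'0.
  apply/eqP; rewrite eq_le; apply/andP; split.
    have /properP[_ [k _ ks]] := valP s.
    have dk : d k <= 0 by rewrite /d {1}/extend (negbTE ks) sub0r oppr_le0.
    by rewrite -(pmulr_lle0 _ (qp k)) -dq pmulr_rle0.
  have /properP[_ [k _ ks]] := valP s'.
  have dk : 0 <= d k by rewrite /d {2}/extend (negbTE ks) subr0.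
  by rewrite -(pmulr_lge0 _ (qp k)) -dq pmulr_rge0.
move=> i; apply/eqP; rewrite -subr_eq0; apply/eqP.
have /eqP := dq i; rewrite d0 mul0r mulf_eq0 (gt_eqF (qp _)) => /eqP; exact.
Qed.

Lemma extendK (s t : fan n) a :
  val s \subset val t -> extend t (extend s a) =1 extend s a.
Proof.
move=> st i; rewrite {1}/extend; case: ifPn => // it; rewrite /extend ifN //.
by apply: contra it => /(fintype.subsetP st).
Qed.

Lemma coordinates_sup (s t : fan n) a g : val s \subset val t ->
  coordinates v s a g -> coordinates v t (extend s a) g.
Proof.
move=> st /coordinates_extend gE; apply/coordinates_extend; rewrite gE.
by apply: eq_bigr => i _; rewrite extendK.
Qed.

Section OpenBox.
Variables (s : fan n) (b : 'I_n.+1 -> rat) (g : 'rV[int]_n).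
Hypothesis b01 : forall i, i \in val s -> 0 < b i < 1.
Hypothesis bg : coordinates v s b g.

Lemma extend_in_box t : in_box t (extend s b).
Proof.
move=> i _; rewrite /extend; case: ifP => [/b01/andP[/ltW -> ->] //|_].
by rewrite lexx ltr01.
Qed.

Lemma box_coordinates t a : in_box t a -> coordinates v t a g ->
  val s \subset val t /\ (forall i, i \in val t -> a i = extend s b i).
Proof.
move=> ta ag; have ab : extend t a =1 extend s b.
  apply: nonneg_coordinates_unique ag bg; first by move=> i /ta/andP[].
  by move=> i /b01/andP[/ltW].
split=> [|i ti]; last by rewrite -ab /extend ti.
apply/fintype.subsetP => i si; apply: contraT => it.
have := ab i; rewrite /extend si (negbTE it) => b0.
by have := b01 si; rewrite -b0 ltxx.
Qed.

Lemma local_group_sub t : local_group v t g <-> val s \subset val t.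
Proof.
split=> [[a ta ag]|st]; first by have [] := box_coordinates ta ag.
by exists (extend s b); [exact: extend_in_box|exact: coordinates_sup].
Qed.

(** An eigenvalue exp(2 pi i a_j) with a_j in [0, 1) is 1 only if a_j = 0. *)
Lemma fixed_setP k a x : in_box (max_cone k) a -> coordinates v (max_cone k) a g ->
  fixed_set (R := R) k a x <-> forall j, lift k j \in val s -> x 0 j = 0.
Proof.
move=> ka ag; have [sk ab] := box_coordinates ka ag.
have aj j : a (lift k j) = extend s b (lift k j).
  by apply: ab; rewrite !inE eq_sym neq_lift.
have xE j : (x *m action_mx R k a) 0 j = x 0 j * expi R (extend s b (lift k j)).
  by rewrite mul_mx_diag !mxE aj.
split=> [xa j js|xs].
  have := xE j; rewrite xa => /eqP.
  rewrite eq_sym -subr_eq0 -{2}[x 0 j]mulr1 -mulrBr mulf_eq0.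
  case/orP => [/eqP //|]; rewrite subr_eq0 -(expi0 R) => /eqP.
  have /andP[b0 b1] := b01 js.
  move=> /expi_inj E; suff : extend s b (lift k j) = 0.
    by rewrite /extend js => bj; rewrite bj ltxx in b0.
  apply: E; last by rewrite lexx ltr01.
  by apply: (@extend_in_box (max_cone k)); rewrite !inE eq_sym neq_lift.
apply/rowP => j; rewrite xE /extend; case: ifP => [/xs ->|_]; first by rewrite mul0r.
by rewrite expi0 mulr1.
Qed.
End OpenBox.

(** The cone is generated by the rays on which the coordinates do not vanish. *)
Lemma local_group_open_box t g : local_group v t g ->
  exists s, [/\ val s \subset val t & exists l, open_box_vectors v s l g].
Proof.
move=> [a ta ag].
have sp : [set i in val t | a i != 0]%SET \proper [set: 'I_n.+1]%SET.
  apply: sub_proper_trans (valP t); apply/fintype.subsetP => i.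
  by rewrite inE => /andP[].
exists (proper_cone sp); split.
  by apply/fintype.subsetP => i; rewrite inE => /andP[].
eexists; exists a; split; last reflexivity.
- move=> i /=; rewrite inE => /andP[/ta/andP[a0 ->] ai].
  by rewrite lt_neqAle eq_sym ai a0.
- rewrite /coordinates /= ag; rewrite big_mkcond [RHS]big_mkcond /=.
  apply: eq_bigr => i _; rewrite inE; case: (i \in val t) => //=.
  by case: eqVneq => //= ->; rewrite scale0r.
Qed.

Lemma open_box_unique (s s' : fan n) (l l' : rat) g :
  open_box_vectors v s l g -> open_box_vectors v s' l' g -> s = s' /\ l = l'.
Proof.
move=> [a [a01 ag <-]] [a' [a'01 a'g <-]].
have box t c : (forall i, i \in val t -> 0 < c i < 1) -> in_box t c.
  by move=> c01 i /c01/andP[/ltW -> ->].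
have [ss' _] := box_coordinates a01 ag (box _ _ a'01) a'g.
have [s's E] := box_coordinates a'01 a'g (box _ _ a01) ag.
have ss : s = s' by apply: val_inj; apply/eqP; rewrite finset.eqEsubset ss' s's.
by split=> //; rewrite -ss; apply: eq_bigr => i si; rewrite E // /extend -ss si.
Qed.

(** * Sectors of the inertia orbifold *)

Lemma point_vector_openE (W : set P) : open W <-> point_vector_open W.
Proof. by []. Qed.

Lemma inertia_chart_continuous k a g :
  in_box (max_cone k) a -> coordinates v (max_cone k) a g ->
  continuous (@inertia_chart R n v k a g).
Proof. by move=> ka ag; apply/continuousP => W /point_vector_openE; apply. Qed.

Lemma fst_point_continuous : continuous (fst : P -> X).
Proof.
apply/continuousP => U oU; apply/point_vector_openE => k a g _ _.
rewrite -comp_preimage; move: U oU; apply/continuousP.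
move=> x B fB; have ic := @initial_continuous (set_type (fixed_set k a)) _ val x.
have := ic _ (@chart_continuous k (val x) B fB).
by rewrite nbhs_simpl.
Qed.

Lemma fiber_open g : open [set y : P | y.2 = g].
Proof.
apply/point_vector_openE => k a g' _ _.
have [->|gg] := pselect (g' = g).
  rewrite (_ : _ @^-1` _ = setT); first exact: openT.
  by apply/seteqP; split.
rewrite (_ : _ @^-1` _ = set0); first exact: open0.
by apply/seteqP; split.
Qed.

Lemma fiber_closed g : closed [set y : P | y.2 = g].
Proof.
rewrite -openC (_ : ~` _ = \bigcup_(g' in [set g' | g' <> g]) [set y : P | y.2 = g']).
  by apply: bigcup_open => g' _; exact: fiber_open.
apply/seteqP; split=> y /=; first by move=> yg; exists y.2.
by move=> [g' /= gg' ->].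
Qed.

Section Sector.
Variables (s : fan n) (l : rat) (g : 'rV[int]_n).
Hypothesis slg : open_box_vectors v s l g.

Definition sector : set P := [set y | orbit_closure s y.1 /\ y.2 = g].

Lemma inertia_fiber p : inertia ((p, g) : P) <-> orbit_closure s p.
Proof.
have [b [b01 bg _]] := slg; split=> [[t /= tp tg]|[z sz zp]].
  have [z [zt zp]] := (torus_orbitP _ _).1 tp.
  by exists z => //; rewrite zt; exact/(local_group_sub b01 bg).
have [x _ [zx _]] := zp; have zprop := zeros_proper zx.
pose t : fan n := proper_cone zprop.
exists t => /=; first by apply/torus_orbitP; exists z.
exact/(local_group_sub b01 bg).
Qed.

Lemma chart_box k : k \notin val s ->
  exists2 a, in_box (max_cone k) a & coordinates v (max_cone k) a g.
Proof.
have [b [b01 bg _]] := slg => ks.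
suff /(local_group_sub b01 bg)[a] : val s \subset val (max_cone k) by exists a.
by apply/fintype.subsetP => i si; rewrite !inE; apply: contraNneq ks => <-.
Qed.

Lemma fixed_orbit_closure k a x : k \notin val s ->
  in_box (max_cone k) a -> coordinates v (max_cone k) a g ->
  fixed_set (R := R) k a x <-> orbit_closure s (chart v k x).
Proof.
have [b [b01 bg _]] := slg => ks ka ag.
rewrite (fixed_setP b01 bg x ka ag) orbit_closure_chart.
by split=> [|[]].
Qed.

(** The crucial comparison of topologies: over the orbit closure, the topology
    coming from the charts of the inertia orbifold is not finer than the one of
    the toric variety. *)
Lemma sector_trace_closed (W : set P) : open W ->
  closed [set p | orbit_closure s p /\ ~ W (p, g)].
Proof.
move=> oW; apply: (closed_in_orbit_closure (s := s)) => [p []//|k ks].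
have [a ka ag] := chart_box ks.
have [U oU UW] := oW k a g ka ag.
rewrite (_ : [set x | _] = (chart v k @^-1` orbit_closure s) `&` ~` U).
  apply: closedI; last exact: open_closedC.
  apply: preimage_closed; last exact: orbit_closure_closed.
  by move=> x _; exact: chart_continuous.
apply/seteqP; split=> x /= [xs xW]; split=> // H; apply: xW.
  have fx := (fixed_orbit_closure x ks ka ag).2 xs.
  have : (val @^-1` U) (exist _ x (mem_set fx)) by [].
  by rewrite UW.
have fx := (fixed_orbit_closure x ks ka ag).2 xs.
have : (@inertia_chart R n v k a g @^-1` W) (exist _ x (mem_set fx)) by [].
by rewrite -UW.
Qed.

Lemma sing_map_fst : sing_map R sector (orbit_closure s) (fst : P -> X).
Proof.
move=> k f fc fS; split=> [x|x]; last by have [] := fS x.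
by apply: continuous_comp; [exact: fc|exact: fst_point_continuous].
Qed.

Lemma sing_map_pair : sing_map R (orbit_closure s) sector (fun p : X => (p, g) : P).
Proof.
move=> k f fc fS; split=> [|x]; last by split; [exact: fS|].
apply/continuousP => W oW.
rewrite -[X in open X]setCK openC.
rewrite (_ : ~` _ = f @^-1` [set p | orbit_closure s p /\ ~ W (p, g)]).
  by apply: preimage_closed; [move=> x _; exact: fc|exact: sector_trace_closed].
by apply/seteqP; split=> x /= H; [split=> //; exact: fS|exact: H.2].
Qed.

Lemma sector_cohomology p :
  lmod_iso (rat_cohomology R sector p)
    (rat_cohomology R (closure (@torus_orbit R n v s)) p).
Proof.
rewrite closure_torus_orbit.
apply: (rat_cohomology_iso sing_map_fst sing_map_pair) => [[x g'] [_ /= <-] //|//].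
Qed.

Lemma sector_sub_inertia : sector `<=` @inertia R n v.
Proof. by move=> [p g'] [ps /= ->]; apply/inertia_fiber. Qed.

(** In the linear chart the segment from the point to the base point, whose
    coordinates are 0 on s and 1 elsewhere, stays in the fixed set. The base point
    is the same for all charts, since it is given by homogeneous coordinates. *)
Lemma sector_base : exists p0, orbit_closure s p0 /\
  forall p, orbit_closure s p -> exists A : set P,
    [/\ connected A, A `<=` sector, A (p0, g) & A (p, g)].
Proof.
pose z0 i : C := if i \in val s then 0 else 1.
have z0s : zeros z0 \subset val s.
  by apply/fintype.subsetP => i; rewrite inE /z0; case: ifP => //; rewrite oner_eq0.
have sz0 : val s \subset zeros z0.
  by apply/fintype.subsetP => i si; rewrite inE /z0 si.
have [p0 zp0] := coords_ex z0s.
exists p0; split; first by exists z0.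
move=> p [z sz zp]; have [k zk] := coords_neq0 zp.
have ks : k \notin val s.
  by apply: contraNN zk => /(fintype.subsetP sz); rewrite inE.
have [x px xz] := coords_to_chart zp zk.
have z0k : z0 k != 0 by rewrite /z0 (negbTE ks) oner_neq0.
have [x0 px0 xz0] := coords_to_chart zp0 z0k.
have [a ka ag] := chart_box ks.
pose y (t : R) : 'rV[C]_n := \row_j ((1 - t)%:C%C * x0 0 j + t%:C%C * x 0 j).
have yfix (t : R) : fixed_set k a (y t).
  apply/(fixed_orbit_closure _ ks ka ag)/orbit_closure_chart; split=> // j js.
  have x_0 : x 0 j = 0.
    by apply/eqP; rewrite xz; have := fintype.subsetP sz _ js; rewrite inE.
  have x0_0 : x0 0 j = 0.
    by apply/eqP; rewrite xz0; have := fintype.subsetP sz0 _ js; rewrite inE.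
  by rewrite mxE x_0 x0_0 !mulr0 addr0.
pose yf (t : R) : set_type (fixed_set k a) := exist _ (y t) (mem_set (yfix t)).
have yfc : continuous yf.
  apply: continuous_comp_initial.
  have -> : val \o yf = y by [].
  apply: row_continuous => j.
  have -> : (fun t : R => y t 0 j) =
      (fun t : R => (1 - t)%:C%C * x0 0 j + t%:C%C * x 0 j).
    by apply/funext => t; rewrite mxE.
  move=> t; apply: cvgD; apply: cvgMl.
    have oc : continuous (fun t : R => 1 - t).
      by move=> u; apply: cvgB; [exact: cvg_cst|exact: cvg_id].
    by have := continuous_comp (oc t) (@real_complex_continuous R (1 - t)).
  exact: real_complex_continuous.
pose path (t : R) : P := inertia_chart v g (yf t).
have pathc : continuous path.
  move=> t; apply: continuous_comp; first exact: yfc.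
  exact: inertia_chart_continuous.
exists (path @` `[0, 1]); split.
- apply: connected_continuous_connected; first exact: segment_connected.
  exact: continuous_subspaceT.
- move=> _ [t _ <-]; split=> //=.
  exact/(fixed_orbit_closure _ ks ka ag).
- exists 0; first by rewrite /= in_itv /= lexx ler01.
  rewrite /path /inertia_chart /= px0; congr (chart _ _ _, _).
  by apply/rowP => j; rewrite mxE subr0 mul1r mul0r addr0.
- exists 1; first by rewrite /= in_itv /= lexx ler01.
  rewrite /path /inertia_chart /= px; congr (chart _ _ _, _).
  by apply/rowP => j; rewrite mxE subrr mul1r mul0r add0r.
Qed.

Lemma sector_nonempty : exists p : X, orbit_closure s p.
Proof. by have [p [sp _]] := sector_base; exists p. Qed.

(** Vectors of N are locally constant on the inertia orbifold, hence constant on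
    connected sets. *)
Lemma sector_component p : orbit_closure s p ->
  connected_component (@inertia R n v) ((p, g) : P) = sector.
Proof.
move=> sp; have [p0 [sp0 base]] := sector_base.
apply/seteqP; split=> [y [A [Ap AI cA] Ay]|[p' g'] [sp' /= ->]].
  have yg : y.2 = g.
    have AE := cA (A `&` [set y | y.2 = g]).
    have : A `&` [set y : P | y.2 = g] = A.
      apply: AE; first by exists (p, g).
        by exists [set y : P | y.2 = g] => //; exact: fiber_open.
      by exists [set y : P | y.2 = g] => //; exact: fiber_closed.
    by move=> E; move: Ay; rewrite -E => -[].
  have Iy := AI _ Ay; split=> //.
  by apply/inertia_fiber; rewrite -yg -surjective_pairing.
have [A [cA As Ap0 Ap]] := base _ sp; have [A' [cA' As' Ap0' Ap']] := base _ sp'.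
exists (A `|` A'); last by right.
split; first by left.
  by move=> u [/As|/As'] /sector_sub_inertia.
by apply: connectedU => //; exists (p0, g).
Qed.
End Sector.

(** * Degree shifts *)

Lemma char_poly_action (k : 'I_n.+1) (a : 'I_n.+1 -> rat) :
  char_poly (action_mx R k a) = \prod_j ('X - (expi R (a (lift k j)))%:P) :> {poly C}.
Proof.
rewrite char_poly_trig ?diag_mx_is_trig //; apply: eq_bigr => j _.
by rewrite !mxE eqxx mulr1n.
Qed.

Section OpenBox.
Variables (s : fan n) (l : rat) (g : 'rV[int]_n).
Hypothesis slg : open_box_vectors v s l g.

Lemma degree_shift_at_unique (p : toric_variety R v) l' :
  degree_shift_at (p, g) l' -> l' = l.
Proof.
have [b [b01 bg bl]] := slg.
move=> [s' [k [a [m [e [_ [ka ag] [[m0 _ _] em] ce ->]]]]]].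
have [sk ab] := box_coordinates b01 bg ka ag.
have ks : k \notin val s.
  by apply/negP => /(fintype.subsetP sk); rewrite !inE eqxx.
have kj j : lift k j \in val (max_cone k) by rewrite !inE eq_sym neq_lift.
have mp : 0 < m%:R :> rat by rewrite ltr0n.
transitivity (\sum_j a (lift k j)).
  apply: (@sum_expi R) => [j|j|]; last by rewrite -ce char_poly_action.
    by rewrite divr_ge0 ?ler0n //= ltr_pdivrMr // mul1r ltr_nat.
  exact: ka.
rewrite -bl [RHS]big_mkcond [RHS](bigD1_ord k) //= (negbTE ks) add0r.
by apply: eq_bigr => j _; rewrite ab // /extend; case: ifP.
Qed.

Lemma coordinates_mul (s' : fan n) (a : 'I_n.+1 -> rat) (c : 'I_n.+1 -> int)
    (m : nat) :
  coordinates v s' a g ->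
  (g *+ m = \sum_(i in val s') c i *: v i <->
   forall i, i \in val s' -> a i * m%:R = (c i)%:~R).
Proof.
move=> ag.
have gmE : map_mx (intr : int -> rat) (g *+ m) =
    \sum_(i in val s') (a i * m%:R) *: map_mx intr (v i).
  rewrite raddfMn /= ag -sumrMnl; apply: eq_bigr => i _.
  by rewrite mulrC -scalerA scaler_nat.
have cE : map_mx (intr : int -> rat) (\sum_(i in val s') c i *: v i) =
    \sum_(i in val s') (c i)%:~R *: map_mx intr (v i).
  by rewrite raddf_sum /=; apply: eq_bigr => i _; rewrite map_mxZ.
split=> [gc i si|ac]; last first.
  suff /rowP E : map_mx (intr : int -> rat) (g *+ m) =
      map_mx intr (\sum_(i in val s') c i *: v i).
    by apply/rowP => j; have := E j; rewrite !mxE => /intr_inj.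
  by rewrite gmE cE; apply: eq_bigr => i /ac ->.
have /properP[_ [k _ ks]] := valP s'.
pose w i := if i \in val s' then a i * m%:R - (c i)%:~R else 0.
have w0 : \sum_i w i *: map_mx intr (v i) = 0.
  transitivity
    (\sum_(i in val s') (a i * m%:R - (c i)%:~R) *: map_mx intr (v i) : 'rV[rat]_n).
    rewrite [RHS]big_mkcond; apply: eq_bigr => j _; rewrite /w.
    by case: ifP; rewrite ?scale0r.
  under eq_bigr do rewrite scalerBl.
  by rewrite sumrB -gmE -cE gc subrr.
have := v_free w0 (k := k); rewrite /w (negbTE ks) => /(_ erefl i).
by rewrite si => /eqP; rewrite subr_eq0 => /eqP.
Qed.

(** A common denominator of the coordinates of g multiplies g into the sublattice. *)
Lemma has_order_exists (s' : fan n) :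
  val s \subset val s' -> exists m : nat, has_order v s' g m.
Proof.
move=> ss'; have [b [b01 bg bl]] := slg.
have b'g := coordinates_sup ss' bg; set b' := extend s b in b'g.
pose D := (\prod_i `|denq (b' i)|)%N.
have D0 : (0 < D)%N by rewrite prodn_gt0 // => i; rewrite absz_gt0 denq_neq0.
pose c i : int := numq (b' i) * (\prod_(j | j != i) `|denq (b' j)|)%N%:Z.
have DE : g *+ D = \sum_(i in val s') c i *: v i.
  apply/(coordinates_mul _ _ b'g) => i _.
  rewrite /D (bigD1 i) //= natrM rmorphM /= mulrA; congr (_ * _).
  rewrite -{1}(divq_num_den (b' i)).
  have -> : (`|denq (b' i)|%N%:R : rat) = (denq (b' i))%:~R.
    by rewrite natr_absz gtr0_norm // denq_gt0.
  by rewrite divfK // intr_eq0 denq_neq0.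
have exm : exists m : nat, `[< (0 < m)%N /\ sublattice v s' (g *+ m) >].
  by exists D; apply/asboolP; split=> //; exists c.
have [m /asboolP[m0 sm] mmin] := ex_minnP exm.
by exists m; split=> // m' m'0 sm'; apply: mmin; apply/asboolP.
Qed.

(** The numerators over the order m of g are obtained by writing g *+ m in the
    sublattice. *)
Lemma degree_shift_at_exists (p : toric_variety R v) :
  orbit_closure s p -> degree_shift_at (p, g) l.
Proof.
have [b [b01 bg bl]] := slg.
move=> [z sz zp]; have [x _ [zx _]] := zp; have zprop := zeros_proper zx.
pose s' : fan n := proper_cone zprop.
have [k ks' s'k] := max_cone_sup s'.
have [m mo] := @has_order_exists s' sz.
have [m0 [c gc] _] := mo; have mp : 0 < m%:R :> rat by rewrite ltr0n.
pose b' := extend s b.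
have b'g : coordinates v s' b' g by exact: coordinates_sup.
have bc := (coordinates_mul c m b'g).1 gc.
have b'0 i : i \notin val s' -> b' i = 0.
  by move=> is'; rewrite /b' /extend ifN //; apply: contra is' => /(fintype.subsetP sz).
have b'01 i : 0 <= b' i < 1.
  by rewrite /b' /extend; case: ifP => [/b01/andP[/ltW -> ->]//|_]; rewrite lexx ltr01.
pose c' i := if i \in val s' then c i else 0.
have bc' i : b' i * m%:R = (c' i)%:~R.
  by rewrite /c'; case: ifPn => [/bc //|/b'0 ->]; rewrite mul0r.
pose e j := `|c' (lift k j)|%N.
have eE j : (e j)%:R = b' (lift k j) * m%:R.
  rewrite bc' /e natr_absz ger0_norm // -(ler0z rat) -bc'.
  by have /andP[b0 _] := b'01 (lift k j); rewrite mulr_ge0 // ltW.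
have eb j : (e j)%:R / m%:R = b' (lift k j) by rewrite eE mulfK // gt_eqF.
have sk : val s \subset val (max_cone k) := fintype.subset_trans sz s'k.
exists s', k, b', m, e; split.
- by split=> //=; apply/torus_orbitP; exists z.
- by split; [exact: extend_in_box|exact: coordinates_sup].
- split=> // j; rewrite -(ltr_nat rat) eE -[ltRHS]mul1r ltr_pM2r //.
  by have /andP[] := b'01 (lift k j).
- by rewrite char_poly_action; apply: eq_bigr => j _; rewrite eb.
- under eq_bigr do rewrite eb.
  rewrite -bl [LHS]big_mkcond [LHS](bigD1_ord k) //= ifN ?add0r //.
  by apply: contra ks' => /(fintype.subsetP sz).
Qed.

Lemma degree_shift_sector : degree_shift (sector s g) = l.
Proof.
have [p sp] := sector_nonempty slg.
apply: xget_unique.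
  by exists (p, g); [split|exact: degree_shift_at_exists].
by move=> l' [[p' g'] [_ /= ->]]; exact: degree_shift_at_unique.
Qed.
End OpenBox.

(** * Assembling the cohomology *)

Lemma sectors_sector S : @sectors R n v S <->
  exists s l g, open_box_vectors v s l g /\ S = sector s g.
Proof.
split=> [[[p g] [t tp tg] ->]|[s [l [g [slg ->]]]]].
  have [s [st [l slg]]] := local_group_open_box tg.
  exists s, l, g; split=> //; apply: (sector_component slg).
  by apply/(inertia_fiber slg); exists t.
have [p sp] := sector_nonempty slg.
exists (p, g); first exact/(inertia_fiber slg).
by rewrite (sector_component slg).
Qed.

Lemma sector_inj (s s' : fan n) (l l' : rat) (g g' : 'rV[int]_n) :
  open_box_vectors v s l g -> open_box_vectors v s' l' g' ->
  sector s g = sector s' g' -> [/\ s = s', l = l' & g = g'].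
Proof.
move=> slg s'l'g' E; have [p sp] := sector_nonempty slg.
have [_ /= gg'] : sector s' g' ((p, g) : point_vector R v) by rewrite -E.
by move: s'l'g'; rewrite -gg' => s'l'g; have [] := open_box_unique slg s'l'g.
Qed.

Local Notation box sl := (set_type (open_box_vectors v sl.1 sl.2)).

(** The isomorphism for any family of rays with exactly one linear relation, with
    positive coefficients: reindex the sectors by pairs of a cone and a box vector,
    compare the summands, and collect the vectors with the same cone and degree. *)
Theorem orbifold_cohomology_sum (p : rat) :
  lmod_iso (orbifold_cohomology R v p)
    (direct_sum (fun sl : fan n * rat =>
       tensor
         (rat_cohomology R (closure (@torus_orbit R n v sl.1)) (p - 2 * sl.2))
         (free_module rat (box sl)))).
Proof.
pose I := {sl : fan n * rat & box sl}.
have Isec (i : I) : sectors (sector (tag i).1 (val (tagged i))).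
  apply/sectors_sector; exists (tag i).1, (tag i).2, (val (tagged i)).
  by split=> //; exact: set_valP.
pose phi (i : I) : set_type (@sectors R n v) :=
  exist (fun S => S \in @sectors R n v) _ (mem_set (Isec i)).
pose V (S : set_type (@sectors R n v)) :=
  rat_cohomology R (val S) (p - 2 * degree_shift (val S)).
pose H (sl : fan n * rat) :=
  rat_cohomology R (closure (@torus_orbit R n v sl.1)) (p - 2 * sl.2).
apply: (lmod_iso_trans (W := direct_sum (V \o phi))).
  apply: direct_sum_reindex => [i i'|[S SS]].
    case: i i' => [[s l] t] [[s' l'] t'] /(congr1 val) /= E.
    have [ss' ll' tt'] : [/\ s = s', l = l' & val t = val t'] :=
      sector_inj (set_valP t) (set_valP t') E.
    by subst s' l'; congr existT; exact: val_inj.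
  have [s [l [g [slg E]]]] := (sectors_sector S).1 (set_mem SS).
  exists (existT _ (s, l)
    (exist (fun u => u \in open_box_vectors v s l) g (mem_set slg))).
  by apply: val_inj; rewrite /= E.
apply: (lmod_iso_trans (W := direct_sum (fun i : I => H (tag i)))).
  apply: direct_sum_iso => -[[s l] t].
  have slt : open_box_vectors v s l (val t) := set_valP t.
  change (lmod_iso (rat_cohomology R (sector s (val t))
      (p - 2 * degree_shift (sector s (val t))))
    (rat_cohomology R (closure (@torus_orbit R n v s)) (p - 2 * l))).
  rewrite (degree_shift_sector slt).
  exact: (sector_cohomology slt).
apply: lmod_iso_trans (lmod_iso_sym (direct_sum_sigma (fun sl (_ : box sl) => H sl))) _.
by apply: direct_sum_iso => sl; apply: lmod_iso_sym; exact: tensor_free_iso.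
Qed.
End WeightedFan.

Theorem theorem4p4p1 (R : realType) (n : nat) (q : n.+1.-tuple nat)
    (q_gt0 : forall i, (0 < tnth q i)%N)
    (gcd_q : \big[gcdn/0%N]_(i < n.+1) tnth q i = 1%N)
    (p : rat) (p_range : 0 <= p <= (2 * n)%:R) :
  lmod_iso (orbifold_cohomology R (wps_ray q) p)
    (direct_sum (fun sl : fan n * rat =>
       let sigma := sl.1 in let l := sl.2 in
       tensor
         (rat_cohomology R (closure (@torus_orbit R n (wps_ray q) sigma)) (p - 2 * l))
         (free_module rat (set_type (open_box_vectors (wps_ray q) sigma l))))).
Proof.
exact: (orbifold_cohomology_sum R q_gt0 (wps_ray_relation q_gt0)
  (wps_ray_relations q_gt0)).
Qed.
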